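(* Assume that $F$ is $\mu$-strongly convex with $\mu>0$, that $f(\cdot;\xi)$ is $L$-smooth and convex for every realization of $\xi$, and that the shared memory is consistent with (constant) delay $\tau$. Let $w_*$ be the unique minimizer of $F$. Consider the Hogwild! general recursion $$w_{t+1}=w_t-\eta_t d_{\xi_t}S^{\xi_t}_{u_t}\nabla f(\hat w_t;\xi_t),\qquad t\ge0,$$ with filter parameter $D$ and with stepsizes satisfying $$0<\eta_t=\frac{1}{LD(2+\beta)(k+t)}<\frac{1}{4LD}\quad (t\ge 0),\qquad \beta>0,\quad k\ge3\tau .$$ Then, with probability one, $\|w_t-w_*\|\to0$ as $t\to\infty$.
   Context: Problem: $\xi$ is a random variable, $f(\cdot;\xi):\mathbb{R}^d\to\mathbb{R}$ is differentiable for every realization, $F(w)=\mathbb{E}[f(w;\xi)]$ and $\mathbb{E}[\nabla f(w;\xi)]=\nabla F(w)$ for every $w$. Norms are Euclidean. $\mu$-strong convexity: $F(w)-F(w')\ge\langle\nabla F(w'),w-w'\rangle+\frac{\mu}{2}\|w-w'\|^2$ for all $w,w'$. $L$-smoothness ($L>0$ uniform in $\xi$): $\|\nabla f(w;\xi)-\nabla f(w';\xi)\|\le L\|w-w'\|$ for all $w,w'$. Convexity: $f(w;\xi)-f(w';\xi)\ge\langle\nabla f(w';\xi),w-w'\rangle$ for all $w,w'$. The quantity $N=2\mathbb{E}[\|\nabla f(w_*;\xi)\|^2]$ is finite. Filters: $D_\xi\subseteq\{1,\dots,d\}$ is the set of positions $i$ for which there is some $w$ with $[\nabla f(w;\xi)]_i\neq0$;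 $D_\xi$ also denotes the diagonal 0/1 matrix with ones exactly at these positions, and $|D_\xi|$ the number of ones. A positive integer $D$ is fixed. For each $\xi$, non-zero diagonal 0/1 matrices $S^\xi_u$ are fixed with $\sum_uS^\xi_u=D_\xi$, each having $\lfloor|D_\xi|/D\rfloor$ or $\lceil|D_\xi|/D\rceil$ ones on its diagonal; there are $D$ of them if $D\le|D_\xi|$, and $|D_\xi|$ of them (each with a single one) if $D>|D_\xi|$. The number of matrices $S^\xi_u$ is denoted $d_\xi$. Given $\xi_t$, the index $u_t$ is chosen uniformly at random among the $d_{\xi_t}$ indices, so that $d_\xi\mathbb{E}[S^\xi_u\mid\xi]=D_\xi$. Delay: $\hat w_t$ is the (possibly inconsistently) read vector. Shared memory is consistent with delay $\tau$ if for all $t$ the vector $\hat w_t$ includes all updates made up to and including the $(t-\tau)$-th iteration, plus some subset of the single-position updates made in later iterations up to the $t$-th; that is, $$\hat w_t=w_{t-\tau}-\sum_{j=t-\tau}^{t-1}\eta_jd_{\xi_j}\Sigma_{t,j}S^{\xi_j}_{u_j}\nabla f(\hat w_j;\xi_j)$$ for some (possibly random) diagonal 0/1 matrices (masks) $\Sigma_{t,j}$, where $t-\tau$ is read as $\max\{t-\tau,0\}$. With $\sigma_{t-1}=(\Sigma_{t,t-\tau},\dots,\Sigma_{t,t-1})$, let $\mathcal{F}_t$ be the $\sigma$-algebra generated by $w_0$ and all $\xi_j,u_j$ with $j\le t-1$ and all masks $\Sigma_{s,j}$ with $s\le t$ (so $w_t,\hat w_t$ are $\mathcal{F}_t$-measurable).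 The $\xi_t$ are i.i.d. copies of $\xi$, $(\xi_t,u_t)$ is independent of $\mathcal{F}_t$, $w_0$ is a given point, and the stepsizes are deterministic. *)

(* Defs.v *)
From HB Require Import structures.
From mathcomp Require Export all_boot all_order all_algebra.
From mathcomp Require Export all_classical all_reals all_analysis.

Set Implicit Arguments.
Unset Strict Implicit.
Unset Printing Implicit Defensive.

Import Order.TTheory GRing.Theory Num.Theory.
Export numFieldNormedType.Exports.

Local Open Scope classical_set_scope.
Local Open Scope ring_scope.

(* The canonical norm `|v| of the library on 'cV[R]_d is the sup norm; it is
   used only through the (equivalent) topology, in differentiable. *)
Definition dot (R : realType) (d : nat) (v w : 'cV[R]_d) : R :=
  \sum_(i < d) v i 0 * w i 0.

Definition enorm (R : realType) (d : nat) (v : 'cV[R]_d) : R :=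
  Num.sqrt (dot v v).

Definition grad (R : realType) (d : nat) (g : 'cV[R]_d -> R) (w : 'cV[R]_d) :
    'cV[R]_d :=
  \col_(i < d) 'D_(delta_mx i 0) g w.

Definition strongly_convex (R : realType) (d : nat) (mu : R)
    (g : 'cV[R]_d -> R) : Prop :=
  forall w w', g w - g w' >=
    dot (grad g w') (w - w') + mu / 2 * enorm (w - w') ^+ 2.

Definition smooth (R : realType) (d : nat) (L : R) (g : 'cV[R]_d -> R) : Prop :=
  forall w w', enorm (grad g w - grad g w') <= L * enorm (w - w').

Definition grad_convex (R : realType) (d : nat) (g : 'cV[R]_d -> R) : Prop :=
  forall w w', g w - g w' >= dot (grad g w') (w - w').

Definition is_minimizer (R : realType) (d : nat) (g : 'cV[R]_d -> R)
    (w : 'cV[R]_d) : Prop :=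
  forall w', g w <= g w'.

Definition is_mask (R : realType) (d : nat) (A : 'M[R]_d) : bool :=
  is_diag_mx A && [forall i, (A i i == 0) || (A i i == 1)].

Definition ones (R : realType) (d : nat) (A : 'M[R]_d) : nat :=
  #|[pred i | A i i == 1]|.

Definition grad_support (R : realType) (d : nat) (g : 'cV[R]_d -> R) :
    pred 'I_d :=
  [pred i | `[< exists w, grad g w i 0 != 0 >]].

Definition support_mx (R : realType) (d : nat) (g : 'cV[R]_d -> R) : 'M[R]_d :=
  diag_mx (\row_(i < d) (grad_support g i)%:R).

Definition ceil_div (m n : nat) : nat := (m %/ n + ~~ (n %| m))%N.

(* The number d_xi of filters, where g = f(.; xi). *)
Definition nfilters (R : realType) (d : nat) (D : nat) (g : 'cV[R]_d -> R) :
    nat :=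
  if (D <= #|grad_support g|)%N then D else #|grad_support g|.

(* S u is meaningful only for u < nfilters D g; in particular, nothing is
   required of S when the gradient of g vanishes identically. *)
Definition is_filter_family (R : realType) (d : nat) (D : nat)
    (g : 'cV[R]_d -> R) (S : nat -> 'M[R]_d) : Prop :=
  let n := #|grad_support g| in
  [/\ forall u, (u < nfilters D g)%N ->
        [/\ is_mask (S u), S u != 0 &
            ones (S u) = (n %/ D)%N \/ ones (S u) = ceil_div n D],
      (n < D)%N -> forall u, (u < nfilters D g)%N -> ones (S u) = 1%N &
      \sum_(u < nfilters D g) S u = support_mx g].

Definition objective (dO dX : measure_display) (Omega : measurableType dO)
    (Xi : measurableType dX) (R : realType) (P : probability Omega R) (d : nat)
    (f : Xi -> 'cV[R]_d -> R) (xi : Omega -> Xi) (w : 'cV[R]_d) : R :=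
  fine 'E_P[fun o => f (xi o) w]%E.

Definition unbiased_gradient (dO dX : measure_display)
    (Omega : measurableType dO) (Xi : measurableType dX) (R : realType)
    (P : probability Omega R) (d : nat)
    (f : Xi -> 'cV[R]_d -> R) (xi : Omega -> Xi) : Prop :=
  let F := objective P f xi in
  forall w, differentiable F w /\
    forall i, P.-integrable setT (fun o => (grad (f (xi o)) w i 0)%:E) /\
      ('E_P[fun o => (grad (f (xi o)) w i 0)%R] = (grad F w i 0)%R%:E)%E.

Definition same_law (dO dX : measure_display)
    (Omega : measurableType dO) (Xi : measurableType dX) (R : realType)
    (P : probability Omega R) (X Y : {RV P >-> Xi}) : Prop :=
  forall A, measurable A -> distribution P X A = distribution P Y A.

Definition mutually_independent (dO dX : measure_display)
    (Omega : measurableType dO) (Xi : measurableType dX) (R : realType)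
    (P : probability Omega R) (X : nat -> {RV P >-> Xi}) : Prop :=
  forall (s : seq nat) (A : nat -> set Xi),
    uniq s -> (forall i, measurable (A i)) ->
    (P (\bigcap_(i in [set` s]) (X i @^-1` A i)) =
     \prod_(i <- s) P (X i @^-1` A i))%E.

(* Given X, the index U is uniform on {0, .., n X - 1}.  When n X = 0 there is
   no index to choose from and U is unconstrained. *)
Definition uniform_index (dO dX : measure_display)
    (Omega : measurableType dO) (Xi : measurableType dX) (R : realType)
    (P : probability Omega R) (n : Xi -> nat) (X : {RV P >-> Xi})
    (U : {RV P >-> nat}) : Prop :=
  (forall o, (0 < n (X o))%N -> (U o < n (X o))%N) /\
  forall (A : set Xi) (m u : nat), measurable A -> (u < m)%N ->
    (P [set o | [/\ A (X o), n (X o) = m & U o = u]] =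
     (m%:R^-1)%R%:E * P [set o | A (X o) /\ n (X o) = m])%E.

(* (s - tau)%N is truncated: it is max(s - tau, 0). *)
Definition consistent_memory (R : realType) (d : nat) (Omega Xi : Type)
    (f : Xi -> 'cV[R]_d -> R) (D : nat) (S : Xi -> nat -> 'M[R]_d)
    (eta : nat -> R) (tau : nat) (xis : nat -> Omega -> Xi)
    (us : nat -> Omega -> nat) (Sigma : nat -> nat -> Omega -> 'M[R]_d)
    (w what : nat -> Omega -> 'cV[R]_d) : Prop :=
  (forall t j o, (t - tau <= j < t)%N -> is_mask (Sigma t j o)) /\
  forall t o, what t o = w (t - tau)%N o -
    \sum_((t - tau)%N <= j < t)
      (eta j * (nfilters D (f (xis j o)))%:R) *:
        (Sigma t j o *m S (xis j o) (us j o) *m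
         grad (f (xis j o)) (what j o)).

Definition hogwild_recursion (R : realType) (d : nat) (Omega Xi : Type)
    (f : Xi -> 'cV[R]_d -> R) (D : nat) (S : Xi -> nat -> 'M[R]_d)
    (eta : nat -> R) (xis : nat -> Omega -> Xi) (us : nat -> Omega -> nat)
    (w what : nat -> Omega -> 'cV[R]_d) : Prop :=
  forall t o, w t.+1 o = w t o -
    (eta t * (nfilters D (f (xis t o)))%:R) *:
      (S (xis t o) (us t o) *m grad (f (xis t o)) (what t o)).

(* The sigma-algebra F_t.  The deterministic initial point contributes only
   trivial events. *)
Definition history (dO dX : measure_display)
    (Omega : measurableType dO) (Xi : measurableType dX) (R : realType)
    (d : nat) (tau : nat) (xis : nat -> Omega -> Xi)
    (us : nat -> Omega -> nat) (Sigma : nat -> nat -> Omega -> 'M[R]_d)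
    (t : nat) : set (set Omega) :=
  <<s [set E | exists2 j, (j < t)%N &
         preimage_set_system setT (xis j) measurable E \/
         preimage_set_system setT (us j) measurable E] `|`
      [set E | exists s j a b,
         [/\ (s <= t)%N, (s - tau <= j < s)%N &
             preimage_set_system setT (fun o => Sigma s j o a b)
               measurable E]] >>.

Definition independent_of_history (dO dY : measure_display)
    (Omega : measurableType dO) (Y : measurableType dY) (R : realType)
    (P : probability Omega R) (X : Omega -> Y) (G : set (set Omega)) : Prop :=
  forall A E, measurable A -> G E ->
    (P ((X @^-1` A) `&` E) = P (X @^-1` A) * P E)%E.

(* Main.v *)
(* Write x_t = |w_t - w_*|^2 and let G_t be the update direction, so that
   w_{t+1} = w_t - eta_t G_t. For fixed vectors w, v, averaging over the filter
   index and using strong convexity of F together with co-coercivity of the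
   gradients of f(.; xi) gives, once eta + C eta^2 is small,
     E |w - eta G(v) - w_*|^2 + C eta^3 E |G(v)|^2
       <= (1 - eta mu / 2) |w - w_*|^2 + O(eta) |w - v|^2 + O(eta^2).
   With v the delayed read, eta_t |w_t - v|^2 is at most a constant times the
   sum of eta_j^3 |G_j|^2 over the last tau steps; adding to x_t a geometrically
   discounted sum of these terms therefore yields a potential V_t satisfying
     E[V_{t+1} | F_t] <= (1 - a_t) V_t + c_t,
   where sum a_t = oo and sum c_t < oo. Conditional expectations only appear as
   inequalities between integrals over events of F_t; these come from a product
   measure (the sample is independent of F_t) and Tonelli's theorem.
   Divergence of sum a_t makes E V_t small at arbitrarily late times, and the
   maximal inequality for nonnegative supermartingales, applied to V_t plus the
   tail of sum c_s from such a time on, gives V_t -> 0 almost surely.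
   Integrability of V_t is never needed: everything is done on the events
   {V_s <= K}. *)
From HB Require Import structures.
Require Import Defs.
From mathcomp Require Import measurable_realfun ring lra zify.

Set Implicit Arguments.
Unset Strict Implicit.
Unset Printing Implicit Defensive.

Import Order.TTheory GRing.Theory Num.Theory.

Local Open Scope classical_set_scope.
Local Open Scope ring_scope.

(** * Euclidean geometry, masks and filters *)

Lemma dotC (R : realType) (d : nat) (v w : 'cV[R]_d) : dot v w = dot w v.
Proof. by apply: eq_bigr => i _; rewrite mulrC. Qed.

Lemma dotDl (R : realType) (d : nat) (u v w : 'cV[R]_d) :
  dot (u + v) w = dot u w + dot v w.
Proof. by rewrite -big_split; apply: eq_bigr => i _; rewrite mxE mulrDl. Qed.

Lemma dotNl (R : realType) (d : nat) (v w : 'cV[R]_d) : dot (- v) w = - dot v w.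
Proof. by rewrite -sumrN; apply: eq_bigr => i _; rewrite mxE mulNr. Qed.

Lemma dotZl (R : realType) (d : nat) (c : R) (v w : 'cV[R]_d) :
  dot (c *: v) w = c * dot v w.
Proof. by rewrite mulr_sumr; apply: eq_bigr => i _; rewrite mxE mulrA. Qed.

Lemma dotDr (R : realType) (d : nat) (u v w : 'cV[R]_d) :
  dot u (v + w) = dot u v + dot u w.
Proof. by rewrite dotC dotDl !(dotC u). Qed.

Lemma dotNr (R : realType) (d : nat) (v w : 'cV[R]_d) : dot v (- w) = - dot v w.
Proof. by rewrite dotC dotNl dotC. Qed.

Lemma dotZr (R : realType) (d : nat) (c : R) (v w : 'cV[R]_d) :
  dot v (c *: w) = c * dot v w.
Proof. by rewrite dotC dotZl dotC. Qed.

Lemma dot0r (R : realType) (d : nat) (v : 'cV[R]_d) : dot v 0 = 0.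
Proof. by rewrite /dot big1// => i _; rewrite mxE mulr0. Qed.

Definition dot_lin := (dotDl, dotDr, dotNl, dotNr, dotZl, dotZr).

Lemma dot_ge0 (R : realType) (d : nat) (v : 'cV[R]_d) : 0 <= dot v v.
Proof. by apply: sumr_ge0 => i _; rewrite -expr2 sqr_ge0. Qed.

Lemma enorm_sqr (R : realType) (d : nat) (v : 'cV[R]_d) :
  enorm v ^+ 2 = dot v v.
Proof. exact/sqr_sqrtr/dot_ge0. Qed.

Lemma enorm_ge0 (R : realType) (d : nat) (v : 'cV[R]_d) : 0 <= enorm v.
Proof. exact: sqrtr_ge0. Qed.

Lemma dot_young (R : realType) (d : nat) (c : R) (v w : 'cV[R]_d) :
  0 < c -> 2 * dot v w <= c * dot v v + c^-1 * dot w w.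
Proof.
move=> c0; rewrite -subr_ge0.
have -> : c * dot v v + c^-1 * dot w w - 2 * dot v w =
    c^-1 * dot (c *: v - w) (c *: v - w).
  by rewrite !dot_lin (dotC w v); field; rewrite gt_eqF.
by rewrite mulr_ge0 ?dot_ge0// invr_ge0 ltW.
Qed.

Lemma dot_sqrD (R : realType) (d : nat) (v w : 'cV[R]_d) :
  dot (v + w) (v + w) <= 2 * dot v v + 2 * dot w w.
Proof.
have := dot_young v w (@ltr01 R); rewrite invr1 !dot_lin (dotC w v); lra.
Qed.

Lemma smooth_dot (R : realType) (d : nat) (L : R) (g : 'cV[R]_d -> R) w w' :
  smooth L g ->
  dot (grad g w - grad g w') (grad g w - grad g w') <=
    L ^+ 2 * dot (w - w') (w - w').
Proof.
move=> /(_ w w') h; rewrite -!enorm_sqr -exprMn ler_sqr ?nnegrE ?enorm_ge0//.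
exact: le_trans (enorm_ge0 _) h.
Qed.

(* The constant 4 (instead of the sharp 2) comes from using the convexity
   inequality in place of an integral form of Taylor's formula. *)
Lemma cocoercive (R : realType) (d : nat) (L : R) (g : 'cV[R]_d -> R) w w' :
  0 < L -> smooth L g -> grad_convex g ->
  dot (grad g w - grad g w') (grad g w - grad g w') <=
    4 * L * (g w - g w' - dot (grad g w') (w - w')).
Proof.
move=> L0 sm cv; have [h hE] : {h | h = grad g w - grad g w'} by exists (grad g
  w - grad g w').
rewrite -hE; have [H HE] : {H | H = dot h h} by exists (dot h h).
have [s sE] : {s | s = (2 * L)^-1} by exists (2 * L)^-1.
(* [y] is reached from [w] by a step of size [s = 1 / (2 * L)] against the gradient difference.
   Chaining the convexity inequalities from [w'] to [y] and from [y] to [w] bounds the first-order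
   gap below by [s * dot (grad g y - grad g w') h]. *)
pose y := w - s *: h.
have Ls : 2 * L * s = 1 by rewrite sE; field; rewrite gt_eqF.
have s0 : 0 < s by rewrite sE invr_gt0 mulr_gt0.
have h1 := cv y w'; have h2 := cv w y; have h3 := smooth_dot w y sm.
have wy : w - y = s *: h by rewrite /y opprB addrC subrK.
have yw : y - w' = (w - w') - s *: h by rewrite /y addrAC.
have c0 : 0 < 2 :> R by [].
(* Smoothness makes the squared norm of [grad g w - grad g y] at most [H / 4]; Young's inequality
   with constant 2 then shows that replacing [grad g y] by [grad g w] costs at most half of [H]. *)
have := dot_young (grad g w - grad g y) h c0.
rewrite wy yw in h1 h2 h3; move: h1 h2 h3; rewrite !dot_lin -HE => h1 h2 h3 h4.
have hH : H = dot (grad g w) h - dot (grad g w') h by rewrite HE {1}hE !dot_lin.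
have h5 : L ^+ 2 * (s * (s * H)) = H / 4.
  have -> : L ^+ 2 * (s * (s * H)) = (2 * L * s) ^+ 2 * H / 4 by field.
  by rewrite Ls expr1n mul1r.
have h6 : dot (grad g w) h - dot (grad g y) h <= H / 2 by lra.
have h7 : s * (dot (grad g w) h - dot (grad g y) h) <= s * (H / 2).
  by rewrite ler_pM2l.
have h8 : s * H / 2 <= g w - g w' - dot (grad g w') (w - w').
  by have := congr1 (fun x => s * x) hH; rewrite !dot_lin; lra.
rewrite (_ : H = 4 * L * (s * H / 2)); last first.
  have -> : 4 * L * (s * H / 2) = 2 * L * s * H by clear; field.
  by rewrite Ls mul1r.
rewrite dotDr dotNr in h8; apply: ler_wpM2l => //; exact: mulr_ge0 (ltW L0).
Qed.

Lemma mask_mulE (R : realType) (d : nat) (A : 'M[R]_d) (v : 'cV[R]_d) i :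
  is_mask A -> (A *m v) i 0 = A i i * v i 0.
Proof.
case/andP => /is_diag_mxP dA _; rewrite mxE (bigD1 i)//= big1 ?addr0// => j ji.
by rewrite dA ?mul0r// eq_sym.
Qed.

Lemma mask_diag (R : realType) (d : nat) (A : 'M[R]_d) i :
  is_mask A -> A i i = 0 \/ A i i = 1.
Proof. by case/andP => _ /forallP /(_ i) /orP[] /eqP; [left|right]. Qed.

(** The complement of a coordinate projection is again one, hence a contraction. It bounds the part
    of an update that a read has missed. *)
Lemma mask_sub_le (R : realType) (d : nat) (A : 'M[R]_d) (v : 'cV[R]_d) :
  is_mask A -> dot (v - A *m v) (v - A *m v) <= dot v v.
Proof.
move=> mA; apply: ler_sum => i _.
have -> : (v - A *m v) i 0 = v i 0 - A i i * v i 0.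
  by rewrite -mask_mulE// mxE; congr (_ + _); rewrite mxE.
by case: (mask_diag i mA) => ->;
  rewrite ?mul0r ?subr0// mul1r subrr mul0r -expr2 sqr_ge0.
Qed.

Lemma nfilters_le (R : realType) (d D : nat) (g : 'cV[R]_d -> R) :
  (nfilters D g <= D)%N.
Proof. by rewrite /nfilters; case: ifPn => //; rewrite -ltnNge => /ltnW. Qed.

(** The filters add up to the support matrix, and every gradient vanishes outside the support, so
    their sum acts as the identity on gradients. *)
Lemma sum_filter_diag (R : realType) (d D : nat) (g : 'cV[R]_d -> R)
    (S : nat -> 'M[R]_d) y i : is_filter_family D g S ->
  (\sum_(u < nfilters D g) S u i i) * grad g y i 0 = grad g y i 0.
Proof.
case=> _ _ sS; have := congr1 (fun M : matrix _ _ _ => M i i) sS.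
rewrite summxE => ->; rewrite mxE eqxx mulr1n mxE.
have [h|h] := pselect (exists w, grad g w i 0 != 0).
  by rewrite /grad_support /= (asboolT h) mul1r.
rewrite /grad_support /= (asboolF h) mul0r.
by apply/esym/eqP/negP => /negP h'; apply: h; exists y.
Qed.

Lemma sum_filter_dot (R : realType) (d D : nat) (g : 'cV[R]_d -> R)
    (S : nat -> 'M[R]_d) y (a : 'cV[R]_d) : is_filter_family D g S ->
  \sum_(u < nfilters D g) dot a (S u *m grad g y) = dot a (grad g y).
Proof.
move=> fS; rewrite exchange_big; apply: eq_bigr => i _ /=.
rewrite -[in RHS](sum_filter_diag y i fS) mulr_suml mulr_sumr.
apply: eq_bigr => u _; case: fS => + _ _ => /(_ u (ltn_ord u))[mS _ _].
by rewrite mask_mulE.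
Qed.

(** Diagonal entries 0 and 1 are idempotent, which turns each square into an inner product with the
    full gradient. *)
Lemma sum_filter_sqr (R : realType) (d D : nat) (g : 'cV[R]_d -> R)
    (S : nat -> 'M[R]_d) y : is_filter_family D g S ->
  \sum_(u < nfilters D g) dot (S u *m grad g y) (S u *m grad g y) =
  dot (grad g y) (grad g y).
Proof.
move=> fS; rewrite -(sum_filter_dot y _ fS); apply: eq_bigr => u _.
apply: eq_bigr => i _; case: fS => + _ _ => /(_ u (ltn_ord u))[mS _ _].
rewrite mask_mulE//; case: (mask_diag i mS) => ->;
  first by rewrite !mul0r mulr0.
by rewrite !mul1r.
Qed.

(** The cross terms carry one factor [n] and the squares two. After division by the number [n] of
    filters, one [n] survives in front of the squared gradient only; it is later bounded by [D]. *)
Lemma sum_filter_step (R : realType) (d D : nat) (g : 'cV[R]_d -> R)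
    (S : nat -> 'M[R]_d) y (a : 'cV[R]_d) (e k : R) :
  is_filter_family D g S ->
  let n := (nfilters D g)%:R in
  \sum_(u < nfilters D g)
    (dot (a - e *: (n *: (S u *m grad g y))) (a - e *: (n *: (S u *m grad g y)))
     + k * dot (n *: (S u *m grad g y)) (n *: (S u *m grad g y))) =
  n * (dot a a - 2 * e * dot a (grad g y)
       + (e ^+ 2 + k) * n * dot (grad g y) (grad g y)).
Proof.
move=> fS n.
transitivity (\sum_(u < nfilters D g)
   (dot a a - 2 * e * n * dot a (S u *m grad g y)
     + (e ^+ 2 + k) * n ^+ 2 * dot (S u *m grad g y) (S u *m grad g y))).
  by apply: eq_bigr => u _; rewrite !dot_lin [dot (S u *m _) a]dotC; ring.
rewrite !big_split/= sumrN -!mulr_sumr (sum_filter_dot _ _ fS) (sum_filter_sqr _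
  fS).
rewrite sumr_const card_ord -[dot a a *+ _]mulr_natr -/n; ring.
Qed.

(** * Almost sure convergence from a drift inequality *)

Lemma measurable_le_cst (R : realType) (d : measure_display)
    (T : measurableType d) (V : T -> R) (c : R) :
  measurable_fun setT V -> measurable [set o | V o <= c].
Proof.
by move=> mV; rewrite -[X in measurable X]setTI; apply: measurable_fun_le.
Qed.

(* Doob's maximal inequality, localized to an event B: decompose B according to
   the first time at which M exceeds l. *)
Lemma maximal_inequality_n (R : realType) (d : measure_display)
    (T : measurableType d) (P : probability T R) (F : nat -> set (set T))
    (M : nat -> T -> R) (B : set T) (l : R) (s n : nat) :
  (forall t A C, F t A -> F t C -> F t (A `&` C)) ->
  (forall t, F t `<=` F t.+1) -> (forall t, F t `<=` measurable) ->
  (forall t c, F t [set o | M t o <= c]) ->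
  (forall t, measurable_fun setT (M t)) -> (forall t o, 0 <= M t o) ->
  (forall t A, (s <= t)%N -> F t A ->
     (\int[P]_(o in A) (M t.+1 o)%:E <= \int[P]_(o in A) (M t o)%:E)%E) ->
  F s B -> 0 <= l ->
  (l%:E * P (B `&` \bigcup_(i < n) [set o | (l < M (s + i)%N o)%R])
     <= \int[P]_(o in B) (M s o)%:E)%E.
Proof.
move=> FI Fmono Fm FM mM M0 sM FB l0.
(* [A n] is the part of [B] on which the level [l] has not been exceeded before time [s + n]. *)
pose A n := B `&` [set o | forall i, (i < n)%N -> M (s + i)%N o <= l].
have AS m : A m.+1 = A m `&` [set o | M (s + m)%N o <= l].
  rewrite /A -setIA; congr (B `&` _); apply/seteqP; split => o /=.
    by move=> h; split => [i im|]; apply: h => //; exact: ltnW.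
  by move=> [h1 h2] i; rewrite ltnS leq_eqVlt => /orP[/eqP->|/h1].
have FA m : F (s + m)%N (A m).
  elim: m => [|m IH]; last by rewrite AS addnS; apply: Fmono; exact: FI.
  by rewrite addn0 (_ : A 0 = B)//; apply/seteqP; split => o //= -[].
have mA m : measurable (A m) by exact: Fm (FA m).
have mB := Fm _ _ FB.
have mgt i : measurable [set o | (l < M i o)%R].
  rewrite (_ : [set _ | _] = ~` [set o | M i o <= l]).
    exact/measurableC/measurable_le_cst.
  by apply/seteqP; split => o /=; rewrite ltNge => /negP.
have mU m : measurable (B `&` \bigcup_(i < m) [set o | (l < M (s + i)%N o)%R]).
  by apply: measurableI => //; apply: bigcup_measurable => i _.
(* Keeping the integral over the part not yet stopped on the left makes the induction go through: it
   supplies the mass of the next first exceedance. *)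
suff : (\int[P]_(o in A n) (M (s + n)%N o)%:E +
    l%:E * P (B `&` \bigcup_(i < n) [set o | (l < M (s + i)%N o)%R])
     <= \int[P]_(o in B) (M s o)%:E)%E.
  apply: le_trans; rewrite leeDr// integral_ge0// => o _.
  by rewrite lee_fin.
elim: n => [|n IH].
  rewrite bigcup_mkord big_ord0 setI0 measure0 mule0 adde0 addn0.
  by rewrite (_ : A 0 = B)//; apply/seteqP; split => o //= -[].
apply: le_trans IH.
have mMn (D : set T) k : measurable_fun D (EFin \o M k).
  by apply/measurable_EFinP; exact: measurable_funTS.
(* On [H] the level is exceeded for the first time at time [s + n]. *)
pose H := A n `&` [set o | (l < M (s + n)%N o)%R].
have mH : measurable H by exact: measurableI.
have AE : A n = A n.+1 `|` H.
  rewrite AS /H -setIUr (_ : _ `|` _ = setT) ?setIT//.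
  by apply/seteqP; split => o //= _; case: (leP (M (s + n)%N o) l) => h;
    [left|right].
have UE : B `&` \bigcup_(i < n.+1) [set o | (l < M (s + i)%N o)%R] =
    (B `&` \bigcup_(i < n) [set o | (l < M (s + i)%N o)%R]) `|` H.
  rewrite /H; apply/seteqP; split => o /=.
    move=> [Bo [i /= lin h]].
    have [[j jn hj]|nj] := pselect (exists2 j, (j < n)%N & l < M (s + j)%N o).
      by left; split => //; exists j.
    have ei : i = n.
      move: lin; rewrite ltnS leq_eqVlt => /orP[/eqP//|lin].
      by exfalso; apply: nj; exists i.
    right; split; last by rewrite -ei.
    split => // j jn; rewrite leNgt; apply/negP => hj; apply: nj; by exists j.
  move=> [[Bo [i /= lin h]]|[[Bo h] h2]]; split => //;
    first by exists i => //=; exact: ltnW.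
  by exists n => /=.
rewrite UE measureU//; last first.
  apply/seteqP; split => o //= -[[_ [i /= lin h]] [[_ hA] _]].
  by have := hA i lin; rewrite leNgt h.
rewrite [in leRHS]AE ge0_integral_setU//; last 2 first.
- by move=> o _; rewrite lee_fin.
- apply/disj_set2P; rewrite AS /H; apply/seteqP; split => o //= -[[_ +] [_]].
  by rewrite leNgt => /negP.
rewrite ge0_muleDr// [leRHS]addeAC -[leRHS]addeA; apply: leeD;
  last apply: leeD => //.
  by rewrite addnS; apply: sM; [exact: leq_trans (leq_addr n s) _|rewrite AS;
    apply: FI].
rewrite -integral_cst//; apply: ge0_le_integral => //.
- exact: mMn.
- by move=> o [_ /= /ltW]; rewrite lee_fin.
exact: mMn.
Qed.

(** Continuity of [P] from below along the finite unions removes the time horizon. *)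
Lemma maximal_inequality (R : realType) (d : measure_display)
    (T : measurableType d) (P : probability T R) (F : nat -> set (set T))
    (M : nat -> T -> R) (B : set T) (l : R) (s : nat) :
  (forall t A C, F t A -> F t C -> F t (A `&` C)) ->
  (forall t, F t `<=` F t.+1) -> (forall t, F t `<=` measurable) ->
  (forall t c, F t [set o | M t o <= c]) ->
  (forall t, measurable_fun setT (M t)) -> (forall t o, 0 <= M t o) ->
  (forall t A, (s <= t)%N -> F t A ->
     (\int[P]_(o in A) (M t.+1 o)%:E <= \int[P]_(o in A) (M t o)%:E)%E) ->
  F s B -> 0 < l ->
  (P (B `&` \bigcup_i [set o | (l < M (s + i)%N o)%R])
     <= (l^-1)%:E * \int[P]_(o in B) (M s o)%:E)%E.
Proof.
move=> FI Fmono Fm FM mM M0 sM FB l0.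
have mB := Fm _ _ FB.
pose U n := B `&` \bigcup_(i < n) [set o | (l < M (s + i)%N o)%R].
have mgt i : measurable [set o | (l < M i o)%R].
  rewrite (_ : [set _ | _] = ~` [set o | (M i o <= l)%R]).
    exact/measurableC/measurable_le_cst.
  by apply/seteqP; split => o /=; rewrite ltNge => /negP.
have mU m : measurable (U m).
  by apply: measurableI => //; apply: bigcup_measurable => i _.
have UE : B `&` \bigcup_i [set o | (l < M (s + i)%N o)%R] = \bigcup_n U n.
  apply/seteqP; split => o /=.
    by move=> [Bo [i _ h]]; exists i.+1 => //; split => //; exists i => /=.
  by move=> [n _ [Bo [i _ h]]]; split => //; exists i.
have cU : P (U n) @[n --> \oo] --> P (\bigcup_n U n).
  apply: nondecreasing_cvg_mu => //; first exact: bigcup_measurable.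
  move=> m n mn; apply/subsetPset => o [Bo [i /= im h]]; split => //.
  by exists i => //=; exact: leq_trans im mn.
rewrite UE -(cvg_lim _ cU)//; apply: lime_le; first by apply/cvg_ex;
  exists (P (\bigcup_n U n)).
apply: nearW => n; have := @maximal_inequality_n R d T P F M B l s n FI Fmono Fm
  FM mM M0 sM FB (ltW l0).
rewrite -/(U n) => h;
  rewrite -[leLHS]mul1e -(mulVf (lt0r_neq0 l0)) EFinM -muleA.
by apply: lee_wpmul2l => //; rewrite lee_fin invr_ge0 ltW.
Qed.

(** Here [m] and [v] stand for the integrals of the supermartingale and of the potential over one
    event. If [m] stayed above [e], then [v] would stay above [e / 2] once [r] is small, and
    telescoping the drift would bound the partial sums of the divergent series. *)
Lemma drift_gets_small (R : realType) (m v : nat -> \bar R) (a r : nat -> R)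
    (s : nat) (e : R) :
  (forall t, 0 <= m t)%E -> (forall t, 0 <= v t)%E -> (m s < +oo)%E ->
  (forall t, 0 <= a t) -> ~ cvgn (series a) -> r @ \oo --> 0 ->
  (forall t, m t <= v t + (r t)%:E)%E ->
  (forall t, (s <= t)%N -> m t.+1 + (a t)%:E * v t <= m t)%E ->
  0 < e -> exists2 t, (s <= t)%N & (m t < e%:E)%E.
Proof.
move=> m0 v0 ms a0 dva r0 mv drift e0; apply: contrapT => hc.
have me t : (s <= t)%N -> (e%:E <= m t)%E.
  by move=> st; rewrite leNgt; apply/negP => h; apply: hc; exists t.
have e20 : 0 < e / 2 by rewrite divr_gt0.
have [n0 _ hn0] : \forall t \near \oo, r t < e / 2.
  by move/cvgrPdist_lt : r0 => /(_ _ e20); apply: filterS => t;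
    rewrite sub0r normrN => /(le_lt_trans (ler_norm _)).
have mfin t : (s <= t)%N -> (m t < +oo)%E.
  elim: t => [|t IH]; first by rewrite leqn0 => /eqP <-.
  rewrite leq_eqVlt => /orP[/eqP <-//|st].
  apply: le_lt_trans (IH st); apply: le_trans (drift t st).
  by rewrite leeDl// mule_ge0// lee_fin.
pose n := maxn s n0.
have sn : (s <= n)%N := leq_maxl s n0.
have ve t : (n <= t)%N -> ((e / 2)%:E <= v t)%E.
  move=> nt; have := me t (leq_trans sn nt) => /le_trans /(_ (mv t)).
  have := hn0 t (leq_trans (leq_maxr s n0) nt).
  case: (v t) (v0 t) => //= [x|]; rewrite ?leey// !lee_fin => _; lra.
have key j : ((\sum_(n <= i < n + j) a i * (e / 2))%:E + m (n + j)%N <= m n)%E.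
  elim: j => [|j IH]; first by rewrite addn0 big_geq// add0e.
  apply: le_trans IH; rewrite addnS big_nat_recr ?leq_addr//= EFinD -addeA.
  apply: leeD => //; rewrite addeC;
    apply: le_trans (drift _ (leq_trans sn (leq_addr j n))).
  apply: leeD => //; rewrite EFinM; apply: lee_wpmul2l;
    first by rewrite lee_fin.
  exact: ve (leq_addr _ _).
apply: dva; apply: nondecreasing_is_cvgn.
  apply: (@nondecreasing_series _ _ xpredT) => i _ _; exact: a0.
have [c cE] : exists c, m n = c%:E.
  by case: (m n) (m0 n) (mfin n sn) => // c _ _; exists c.
exists (\sum_(0 <= i < n) a i + c / (e / 2)) => _ [k _ <-].
rewrite /series /=; have [kn|/ltnW nk] := leqP k n.
  apply: (@le_trans _ _ (\sum_(0 <= i < n) a i)).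
    rewrite [leRHS](@big_cat_nat _ _ _ k)//= lerDl sumr_ge0// => i _; exact: a0.
  rewrite lerDl divr_ge0 ?(ltW e20)//.
  by have := m0 n; rewrite cE lee_fin.
rewrite (@big_cat_nat _ _ _ n)//= lerD2l ler_pdivlMr// mulr_suml.
have := key (k - n)%N; rewrite subnKC// cE => h.
by rewrite -lee_fin; apply: le_trans h; rewrite leeDl.
Qed.

(** [r t] stands for the tail of the additive errors from time [t] on, so the drift inequality makes
    [V t + r t] a supermartingale that moreover loses [a t] times the integral of [V t]. *)
Lemma ae_cvg0_of_drift (R : realType) (d : measure_display)
    (T : measurableType d) (P : probability T R) (F : nat -> set (set T))
    (V : nat -> T -> R) (a r : nat -> R) (s : nat) :
  (forall t A C, F t A -> F t C -> F t (A `&` C)) ->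
  (forall t, F t `<=` F t.+1) -> (forall t, F t `<=` measurable) ->
  (forall t c, F t [set o | V t o <= c]) ->
  (forall t, measurable_fun setT (V t)) -> (forall t o, 0 <= V t o) ->
  (forall t, 0 <= a t) -> ~ cvgn (series a) ->
  (forall t, 0 <= r t) -> r @ \oo --> 0 ->
  (forall t A, (s <= t)%N -> F t A ->
     (\int[P]_(o in A) (V t.+1 o + r t.+1)%:E +
       (a t)%:E * \int[P]_(o in A) (V t o)%:E
       <= \int[P]_(o in A) (V t o + r t)%:E)%E) ->
  {ae P, forall o, V t o @[t --> \oo] --> 0}.
Proof.
move=> FI Fmono Fm FV mV V0 a0 dva r0 rto drift.
pose M t o := V t o + r t.
have M0 t o : 0 <= M t o by rewrite addr_ge0.
have mM t : measurable_fun setT (M t) by apply: measurable_funD.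
have FM t c : F t [set o | M t o <= c].
  by rewrite (_ : [set _ | _] = [set o | V t o <= c - r t]) //; apply/seteqP;
    split => o /=; rewrite /M lerBrDr.
have FS t u : (t <= u)%N -> F t `<=` F u.
  by move=> /subnK <-; elim: (u - t)%N => // n IH A /IH; rewrite addSn;
    exact: Fmono.
have sM t A : (s <= t)%N -> F t A ->
    (\int[P]_(o in A) (M t.+1 o)%:E <= \int[P]_(o in A) (M t o)%:E)%E.
  move=> st FA; apply: le_trans (drift t A st FA);
    rewrite leeDl// mule_ge0 ?lee_fin//.
  by apply: integral_ge0 => o _; rewrite lee_fin.
(* Localization: on [B K] the starting value is bounded, so its integral is finite; the events [B K]
   exhaust the space. *)
pose B (K : nat) := [set o | M s o <= K%:R].
(* The exceptional event: [M] exceeds [1 / (j + 1)] at arbitrarily late times. *)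
pose N (j K : nat) := B K `&` \bigcap_n \bigcup_i [set o | (j.+1%:R^-1 < M (n +
  i)%N o)%R].
have mgt i c : measurable [set o | (c < M i o)%R].
  rewrite (_ : [set _ | _] = ~` [set o | (M i o <= c)%R]).
    exact/measurableC/measurable_le_cst.
  by apply/seteqP; split => o /=; rewrite ltNge => /negP.
have mB K : measurable (B K) by exact: measurable_le_cst.
have mN j K : measurable (N j K).
  apply: measurableI => //; apply: bigcapT_measurable => n.
  exact: bigcup_measurable.
have PN0 j K : P (N j K) = 0%E.
  apply/eqP; rewrite eq_le measure_ge0 andbT; apply/lee_addgt0Pr => e e0;
    rewrite add0e.
  (* The maximal inequality at level [1 / (j + 1)] multiplies the integral by [j + 1], hence this
     target for the integral. *)
  have e'0 : 0 < e / j.+1%:R by rewrite divr_gt0.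
  have mEM (D : set T) t : measurable_fun D (fun o => (M t o)%:E : \bar R).
    by apply/measurable_EFinP; exact: measurable_funTS.
  have mEV (D : set T) t : measurable_fun D (fun o => (V t o)%:E : \bar R).
    by apply/measurable_EFinP; exact: measurable_funTS.
  have iM0 t : (0 <= \int[P]_(o in B K) (M t o)%:E)%E.
    by apply: integral_ge0 => o _; rewrite lee_fin.
  have iV0 t : (0 <= \int[P]_(o in B K) (V t o)%:E)%E.
    by apply: integral_ge0 => o _; rewrite lee_fin.
  have iMfin : (\int[P]_(o in B K) (M s o)%:E < +oo)%E.
    apply: (@le_lt_trans _ _ (\int[P]_(o in B K) (cst K%:R%:E o))%E).
      by apply: ge0_le_integral => // o _; rewrite lee_fin.
    rewrite integral_cst//; apply: (@le_lt_trans _ _ (K%:R%:E * 1)%E);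
      last by rewrite mule1 ltry.
    by apply: lee_wpmul2l; [rewrite lee_fin|exact: probability_le1].
  have iMV t : (\int[P]_(o in B K) (M t o)%:E <=
      \int[P]_(o in B K) (V t o)%:E + (r t)%:E)%E.
    rewrite /M; under eq_integral do rewrite EFinD.
    rewrite ge0_integralD//; last first.
    + by move=> o _; rewrite lee_fin.
    + by move=> o _; rewrite lee_fin.
    apply: leeD => //; rewrite integral_cst// -[leRHS]mule1.
    by apply: lee_wpmul2l; [rewrite lee_fin|exact: probability_le1].
  (* [B K] belongs to the sigma-algebra of time [s], hence to all later ones, so the drift may be
     integrated over it at every [t >= s]. *)
  have [t st ht] := drift_gets_small iM0 iV0 iMfin a0 dva rto iMV
    (fun t st => drift t _ st (FS s t st _ (FM s K%:R))) e'0.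
  apply: (@le_trans _ _ (P (B K `&` \bigcup_i [set o | (j.+1%:R^-1 < M (t + i)%N
    o)%R]))).
    apply: le_measure; rewrite ?inE//.
      by apply: measurableI => //; exact: bigcup_measurable.
    by move=> o [Bo h]; split => //; exact: h.
  have sM' u A : (t <= u)%N -> F u A ->
      (\int[P]_(o in A) (M u.+1 o)%:E <= \int[P]_(o in A) (M u o)%:E)%E.
    by move=> tu; apply: sM; exact: leq_trans tu.
  apply: le_trans (@maximal_inequality _ _ _ P F M (B K) j.+1%:R^-1 t
    FI Fmono Fm FM mM M0 sM' (FS s t st _ (FM s K%:R)) _) _;
      first by rewrite invr_gt0.
  rewrite invrK (_ : e = j.+1%:R * (e / j.+1%:R)); last by rewrite mulrC divfK.
  by rewrite EFinM; apply: lee_wpmul2l; [rewrite lee_fin|exact: ltW].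
have : P.-negligible (\bigcup_j \bigcup_K N j K).
  apply: negligible_bigcup => j; apply: negligible_bigcup => K.
  by apply/negligibleP; [exact: mN|exact: PN0].
apply: negligibleS => o /= hno; apply: contrapT => hN; apply: hno.
have h j : exists n, forall i, (n <= i)%N -> M i o <= j.+1%:R^-1.
  apply: contrapT => hj; apply: hN; exists j => //.
  have [K hK] : exists K : nat, M s o <= K%:R.
    by exists (Num.bound (M s o)); apply/ltW/archi_boundP.
  exists K => //; split => // n _; apply: contrapT => h; apply: hj;
    exists n => i ni.
  rewrite leNgt; apply/negP => hi; apply: h; exists (i - n)%N => //=.
  by rewrite subnKC.
apply/cvgrPdist_le => e e0; have [j _ hj] := near_infty_natSinv_lt (PosNum e0).
have [n hn] := h j; exists n => // i /= ni; rewrite sub0r normrN ger0_norm//.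
apply: le_trans (ltW (hj j (leqnn j))); apply: le_trans (hn i ni).
by rewrite /M lerDl.
Qed.

(** * Measurability *)

Lemma coord_le_enorm (R : realType) (d : nat) (v : 'cV[R]_d) i :
  `|v i 0| <= enorm v.
Proof.
rewrite -(ler_pXn2r (_ : 0 < 2)%N)// ?nnegrE ?enorm_ge0//.
rewrite enorm_sqr real_normK ?num_real// /dot (bigD1 i)//= -expr2 lerDl.
by apply: sumr_ge0 => j _; rewrite -expr2 sqr_ge0.
Qed.

(** Grid points are indexed by integer vectors, a countable type. A statement about all points, or
    about a random point, thus reduces to countably many fixed points. *)
Definition grid (R : realType) (d n : nat) (z : 'cV[int]_d) : 'cV[R]_d :=
  \col_i ((z i 0)%:~R / n.+1%:R).

Definition grid_index (R : realType) (d n : nat) (v : 'cV[R]_d) : 'cV[int]_d :=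
  \col_i Num.floor (n.+1%:R * v i 0).

Lemma grid_approx (R : realType) (d n : nat) (v : 'cV[R]_d) :
  enorm (grid R n (grid_index n v) - v) <= Num.sqrt d%:R * n.+1%:R^-1.
Proof.
rewrite -(ler_pXn2r (_ : 0 < 2)%N)// ?nnegrE ?enorm_ge0 ?mulr_ge0 ?sqrtr_ge0//.
rewrite enorm_sqr exprMn sqr_sqrtr// mulr_natl.
apply: (@le_trans _ _ (\sum_(i < d) (n.+1%:R^-1 : R) ^+ 2)); last first.
  by rewrite sumr_const card_ord.
apply: ler_sum => i _; rewrite -expr2 -real_normK ?num_real//.
rewrite ler_pXn2r ?nnegrE ?normr_ge0//.
rewrite !mxE; set x := n.+1%:R * v i 0.
have -> : (Num.floor x)%:~R / n.+1%:R - v i 0 = - (n.+1%:R^-1 * (x - (Num.floor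
  x)%:~R)).
  by rewrite /x mulrBr mulKf// opprB [in RHS]mulrC.
have /andP[h1 h2] := floor_itv x; rewrite intrD in h2.
rewrite normrN normrM ger0_norm; last by rewrite invr_ge0.
rewrite ger0_norm; last by rewrite subr_ge0.
by rewrite -[leRHS]mulr1 ler_pM2l ?invr_gt0//; lra.
Qed.

Lemma grid_cvg (R : realType) (d : nat) (g : 'cV[R]_d -> R) (C : R) v :
  (forall v v', `|g v - g v'| <= C * enorm (v - v')) ->
  g (grid R n (grid_index n v)) @[n --> \oo] --> g v.
Proof.
move=> gC; pose K := `|C| * Num.sqrt d%:R.
have : (fun n => K * n.+1%:R^-1) @ \oo --> K * 0.
  by apply: cvgMr; exact: cvg_harmonic.
rewrite mulr0 => /cvgrPdist_le h; apply/cvgrPdist_le => e e0.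
apply: filterS (h e e0) => n; rewrite sub0r normrN; apply: le_trans.
rewrite distrC; apply: le_trans (gC _ _) _; apply: le_trans (ler_norm _).
rewrite /K -mulrA; apply: (@le_trans _ _ (`|C| * enorm (grid R n (grid_index n
  v) - v))).
  by rewrite ler_wpM2r ?enorm_ge0// ler_norm.
by rewrite ler_wpM2l// grid_approx.
Qed.

Lemma measurable_grid_index (R : realType) (d : nat) (dT : measure_display)
    (T : measurableType dT) (U : T -> 'cV[R]_d) (n : nat) (z : 'cV[int]_d) :
  (forall i, measurable_fun setT (fun t => U t i 0)) ->
  measurable [set t | grid_index n (U t) = z].
Proof.
move=> mU.
rewrite (_ : [set _ | _] = \big[setI/setT]_(i < d)
    ((fun t => U t i 0) @^-1`
       [set r | Num.floor (n.+1%:R * r) = z i 0])); last first.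
  apply/seteqP; split => t /=.
    by move=> tz; rewrite -bigcap_seq => i _ /=; rewrite -tz mxE.
  rewrite -bigcap_seq => h; apply/matrixP => i j; rewrite ord1 mxE.
  by apply: h; rewrite /= mem_index_enum.
apply: bigsetI_measurable => i _; rewrite -[X in measurable X]setTI.
apply: mU => //.
rewrite (_ : [set r | _] = `[(z i 0)%:~R / n.+1%:R, (z i 0 + 1)%:~R /
  n.+1%:R[%classic).
  exact: measurable_itv.
apply/seteqP; split => r /=;
  rewrite in_itv /= ler_pdivrMr// ltr_pdivlMr// ![r * _]mulrC.
  by move=> <-; exact: floor_itv.
by move=> h; apply: floor_def.
Qed.

(** A function measurable in one variable and continuous in the other is jointly measurable:
    rounding the second argument to the grid leaves countably many pieces on which it is fixed, and
    the Lipschitz bound passes to the limit. *)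
Lemma measurable_comp_lipschitz (R : realType) (d : nat)
    (dT dY : measure_display) (T : measurableType dT) (Y : measurableType dY)
    (g : Y -> 'cV[R]_d -> R) (C : R) (X : T -> Y) (U : T -> 'cV[R]_d) :
  (forall v, measurable_fun setT (fun y => g y v)) ->
  (forall y v v', `|g y v - g y v'| <= C * enorm (v - v')) ->
  measurable_fun setT X -> (forall i, measurable_fun setT (fun t => U t i 0)) ->
  measurable_fun setT (fun t => g (X t) (U t)).
Proof.
move=> mg gC mX mU.
apply: (@measurable_fun_cvg _ _ _ _
  (fun n t => g (X t) (grid R n (grid_index n (U t))))); last first.
  by move=> t _; apply: grid_cvg (gC (X t)).
move=> n _ A mA; rewrite setTI.
rewrite (_ : _ @^-1` _ = \bigcup_(z : 'cV[int]_d)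
    ([set t | grid_index n (U t) = z] `&`
     (fun t => g (X t) (grid R n z)) @^-1` A)); last first.
  by apply/seteqP; split => t /=; [move=> h;
    exists (grid_index n (U t))|move=> [z _ [<-]]].
apply: countable_bigcupT_measurable => // z.
apply: measurableI; first exact: measurable_grid_index.
rewrite -[X in measurable X]setTI.
by apply: (measurableT_comp (mg (grid R n z)) mX).
Qed.

Lemma grad_quotient_cvg (R : realType) (d : nat) (g : 'cV[R]_d -> R) v i
    (u : nat -> R) :
  differentiable g v -> u @ \oo --> 0 -> (forall n, u n != 0) ->
  (u n)^-1 * (g (u n *: delta_mx i 0 + v) - g v) @[n --> \oo] --> grad g v i 0.
Proof.
move=> dg u0 un0; have : derivable g v (delta_mx i 0) by exact: diff_derivable.
rewrite mxE => /cvg_ex[l hl].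
have -> : 'D_(delta_mx i 0) g v = l by exact: cvg_lim hl.
have hn : u @ \oo --> 0^'.
  move=> A hA; have [N _ hN] := u0 _ hA; exists N => // n Nn.
  exact: (hN n Nn).
exact: (cvg_comp _ _ hn hl).
Qed.

(** A partial derivative is the limit of difference quotients along [1 / (n + 1)], each of them
    measurable. *)
Lemma measurable_grad (R : realType) (dX : measure_display)
    (X : measurableType dX) (d : nat) (f : X -> 'cV[R]_d -> R) v i :
  (forall x v, differentiable (f x) v) ->
  (forall v, measurable_fun setT (fun x => f x v)) ->
  measurable_fun setT (fun x => grad (f x) v i 0).
Proof.
move=> fd mf; apply: (@measurable_fun_cvg _ _ _ _
  (fun n x => n.+1%:R^-1^-1 * (f x (n.+1%:R^-1 *: delta_mx i 0 + v) - f x v))).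
  move=> n; apply: measurable_funM; first exact: measurable_cst.
  exact: measurable_funB.
by move=> x _; apply: grad_quotient_cvg => //; exact: cvg_harmonic.
Qed.

Lemma grad_minimizer (R : realType) (d : nat) (g : 'cV[R]_d -> R) v :
  differentiable g v -> is_minimizer g v -> grad g v = 0.
Proof.
move=> dg gmin; apply/matrixP => i j; rewrite ord1 {j} [RHS]mxE.
(* At a minimizer, quotients along positive steps are nonnegative and those along negative steps
   nonpositive; both converge to the partial derivative. *)
have hp : (fun n : nat => n.+1%:R^-1 : R) @ \oo --> 0 by exact: cvg_harmonic.
have hm : (fun n : nat => - n.+1%:R^-1 : R) @ \oo --> 0.
  by rewrite -oppr0; exact: cvgN.
have p0 n : (n.+1%:R^-1 : R) != 0 by rewrite gt_eqF// invr_gt0.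
have m0 n : (- n.+1%:R^-1 : R) != 0 by rewrite oppr_eq0.
have hP := @grad_quotient_cvg _ _ _ _ i _ dg hp p0.
have hM := @grad_quotient_cvg _ _ _ _ i _ dg hm m0.
apply/eqP; rewrite eq_le; apply/andP; split.
  rewrite -(cvg_lim _ hM)//; apply: limr_le; [by apply/cvg_ex; eexists;
    exact: hM|apply: nearW => n].
  by rewrite mulr_le0_ge0 ?subr_ge0// invr_le0 oppr_le0.
rewrite -(cvg_lim _ hP)//; apply: limr_ge; [by apply/cvg_ex; eexists;
  exact: hP|apply: nearW => n].
by rewrite mulr_ge0 ?subr_ge0//; exact: gmin.
Qed.

Lemma grad_lipschitz (R : realType) (d : nat) (L : R) (g : 'cV[R]_d -> R) v v' i
  :
  smooth L g -> `|grad g v i 0 - grad g v' i 0| <= L * enorm (v - v').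
Proof.
move=> /(_ v v'); apply: le_trans.
have -> : grad g v i 0 - grad g v' i 0 = (grad g v - grad g v') i 0 by rewrite
  !mxE.
exact: coord_le_enorm.
Qed.

(** By continuity of the gradient, a nonzero coordinate at some point is also nonzero at a nearby
    grid point, so the existential ranges over a countable set. *)
Lemma measurable_grad_support (R : realType) (dX : measure_display)
    (X : measurableType dX) (d : nat) (L : R) (f : X -> 'cV[R]_d -> R) i :
  (forall x v, differentiable (f x) v) ->
  (forall v, measurable_fun setT (fun x => f x v)) ->
  (forall x, smooth L (f x)) ->
  measurable [set x | grad_support (f x) i].
Proof.
move=> fd mf sm.
rewrite (_ : [set _ | _] = \bigcup_n \bigcup_(z : 'cV[int]_d)
   ((fun x => grad (f x) (grid R n z) i 0) @^-1` (~` [set 0]))); last first.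
  apply/seteqP; split => x /=.
    move=> /asboolP[v hv].
    have h : grad (f x) (grid R n (grid_index n v)) i 0 @[n --> \oo] --> grad (f
      x) v i 0.
      apply: (@grid_cvg _ _ (fun v => grad (f x) v i 0) L) => v1 v2.
      exact: grad_lipschitz.
    have hv0 : 0 < `|grad (f x) v i 0| by rewrite normr_gt0.
    move/cvgrPdist_lt : h => /(_ _ hv0)[n _ /(_ n (leqnn n)) hn].
    exists n => //; exists (grid_index n v) => //= h0.
    by move: hn; rewrite h0 subr0 ltxx.
  by move=> [n _ [z _ /= h]]; apply/asboolP; exists (grid R n z); apply/eqP.
apply: bigcup_measurable => n _; apply: countable_bigcupT_measurable => // z.
rewrite -[X in measurable X]setTI; apply: measurable_grad => //.
exact: measurableC.
Qed.

(** The number of filters depends on the sample only through the support, one of finitely many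
    subsets of the coordinates. *)
Lemma measurable_nfilters (R : realType) (dX : measure_display)
    (X : measurableType dX) (d D : nat) (L : R) (f : X -> 'cV[R]_d -> R) m :
  (forall x v, differentiable (f x) v) ->
  (forall v, measurable_fun setT (fun x => f x v)) ->
  (forall x, smooth L (f x)) ->
  measurable [set x | nfilters D (f x) = m].
Proof.
move=> fd mf sm.
rewrite (_ : [set _ | _] = \bigcup_(B in [set B : {set 'I_d} |
     (if (D <= #|B|)%N then D else #|B|) = m])
   [set x | [set i | grad_support (f x) i]%SET = B]); last first.
  apply/seteqP; split => x /=.
    move=> nm; exists [set i | grad_support (f x) i]%SET => //=.
    by rewrite -nm /nfilters cardsE.
  by move=> [B /= <- xB]; rewrite /nfilters -xB cardsE.
rewrite bigcup_mkcond.
apply: countable_bigcupT_measurable => // B; case: ifP => // _.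
rewrite (_ : [set _ | _] = \big[setI/setT]_(i < d)
   [set x | grad_support (f x) i = (i \in B)]); last first.
  apply/seteqP; split => x /=.
    by move=> <-; rewrite -bigcap_seq => i _ /=; rewrite inE.
  rewrite -bigcap_seq => h; apply/setP => i; rewrite inE.
  by apply: h; rewrite /= mem_index_enum.
apply: bigsetI_measurable => i _; case: (i \in B).
  exact: measurable_grad_support sm.
rewrite (_ : [set _ | _] = ~` [set x | grad_support (f x) i]).
  by apply: measurableC; exact: measurable_grad_support sm.
by apply/seteqP; split => x /= => [->//|/negP/negbTE].
Qed.

Lemma measurable_fun_glue (dX dY : measure_display) (X : measurableType dX)
    (Y : measurableType dY) (N : X -> nat) (h : X -> Y) :
  (forall m, measurable [set x | N x = m]) ->
  (forall m, measurable_fun [set x | N x = m] h) ->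
  measurable_fun setT h.
Proof.
move=> mN mh _ A mA; rewrite setTI.
rewrite (_ : _ @^-1` _ = \bigcup_m ([set x | N x = m] `&` h @^-1` A)).
  by apply: bigcup_measurable => m _; exact: mh.
by apply/seteqP; split => x /= => [hx|[m _ []//]]; exists (N x).
Qed.

Lemma measurable_fun_prod_nat (dX dY : measure_display) (X : measurableType dX)
    (Y : measurableType dY) (h : X * nat -> Y) :
  (forall k, measurable_fun setT (fun x => h (x, k))) -> measurable_fun setT h.
Proof.
move=> mh _ A mA; rewrite setTI.
rewrite (_ : _ @^-1` _ = \bigcup_k (((fun x => h (x, k)) @^-1` A) `*` [set k])).
  apply: bigcup_measurable => k _; apply: measurableX => //.
  by rewrite -[X in measurable X]setTI; exact: mh.
by apply/seteqP; split => -[x k] /= => [hx|[m _ [/= hx ->]]]; first by exists k.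
Qed.

(** [S x u] is constrained, and measurable in [x], only for indices below the number of filters. The
    value 0 elsewhere makes the coefficient measurable on the whole product. *)
Definition filter_coef (R : realType) (X : Type) (d D : nat)
    (f : X -> 'cV[R]_d -> R) (S : X -> nat -> 'M[R]_d) (i : 'I_d)
    (p : X * nat) : R :=
  if (p.2 < nfilters D (f p.1))%N then
    (nfilters D (f p.1))%:R * S p.1 p.2 i i else 0.

Lemma measurable_filter_coef (R : realType) (dX : measure_display)
    (X : measurableType dX) (d D : nat) (L : R) (f : X -> 'cV[R]_d -> R)
    (S : X -> nat -> 'M[R]_d) i :
  (forall x v, differentiable (f x) v) ->
  (forall v, measurable_fun setT (fun x => f x v)) ->
  (forall x, smooth L (f x)) ->
  (forall u a b,
    measurable_fun [set x | (u < nfilters D (f x))%N] (fun x => S x u a b)) ->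
  measurable_fun setT (filter_coef D f S i).
Proof.
move=> fd mf sm mS; apply: measurable_fun_prod_nat => k.
apply: (@measurable_fun_glue _ _ _ _ (fun x => nfilters D (f x))) => m.
  exact: measurable_nfilters sm.
have [km|km] := ltnP k m; last first.
  apply: (eq_measurable_fun (fun _ : X => 0 : R)) => [x|];
    last exact: measurable_cst.
  by rewrite inE /= => xm; rewrite /filter_coef /= xm ltnNge km.
apply: (eq_measurable_fun (fun x => m%:R * S x k i i : R)) => [x|].
  by rewrite inE /= => xm; rewrite /filter_coef /= xm km.
apply: measurable_funM; first exact: measurable_cst.
apply: measurable_funS (mS k i i) => [|x /= ->//].
rewrite (_ : [set _ | _] = \bigcup_(j in [set j | (k < j)%N]) [set x | nfilters
  D (f x) = j]).
  by apply: bigcup_measurable => j _; exact: measurable_nfilters sm.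
by apply/seteqP; split => x /= => [h|[j /= h ->]//]; exists (nfilters D (f x)).
Qed.

(** * Expectations over the current sample *)

(** This replaces conditioning on [<<s G >>]. Give the first copy of [Omega] only the events of
    [<<s G >>]; by independence the pair [(o, X o)] has the product law there, and Tonelli's theorem
    integrates [X] out with [o] frozen. *)
Lemma freezing_le (R : realType) (dO dY : measure_display)
    (Omega : measurableType dO) (Y : measurableType dY)
    (P : probability Omega R) (G : set (set Omega)) (X : Omega -> Y)
    (h : Omega -> Y -> R) (B : Omega -> R) (A : set Omega) :
  <<s G >> `<=` measurable -> measurable_fun setT X ->
  independent_of_history P X <<s G >> ->
  measurable_fun setT (fun p : g_sigma_algebraType G * Y => h p.1 p.2) ->
  (forall o y, 0 <= h o y) -> <<s G >> A -> measurable_fun setT B ->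
  (forall o, (\int[P]_o' (h o (X o'))%:E <= (B o)%:E)%E) ->
  (\int[P]_(o in A) (h o (X o))%:E <= \int[P]_(o in A) (B o)%:E)%E.
Proof.
move=> Gm mX ind mh h0 GA mB hB.
pose T1 : measurableType _ := g_sigma_algebraType G.
have mid : measurable_fun setT (id : Omega -> T1).
  by move=> _ C mC; rewrite setTI; exact: Gm.
have mpair : measurable_fun setT (fun o => (o, X o) : T1 * Y).
  exact: measurable_fun_pair.
pose idV : {RV P >-> T1} := HB.pack (id : Omega -> T1)
  (isMeasurableFun.Build _ _ _ _ _ mid).
pose XV : {RV P >-> Y} := HB.pack X (isMeasurableFun.Build _ _ _ _ _ mX).
pose pV : {RV P >-> (T1 * Y)%type} := HB.pack (fun o => (o, X o) : T1 * Y)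
  (isMeasurableFun.Build _ _ _ _ _ mpair).
have mA : measurable A by exact: Gm.
pose f (p : T1 * Y) : \bar R := (\1_A p.1 * h p.1 p.2)%:E.
have f0 p : (0 <= f p)%E by rewrite lee_fin mulr_ge0.
have mf : measurable_fun setT f.
  apply/measurable_EFinP; apply: measurable_funM => //.
  apply: (@measurableT_comp _ _ _ _ _ _ (\1_(A : set T1) : T1 -> R)) => //.
(* Independence is equality on rectangles; uniqueness of the product measure extends it to all
   measurable sets. *)
have prodE C : measurable C ->
    (distribution P idV \x distribution P XV)%E C = distribution P pV C.
  move=> mC; apply: (product_measure_unique _ mC) => C1 C2 mC1 mC2.
  have E : distribution P pV (C1 `*` C2) = P (X @^-1` C2 `&` C1).
    by congr (P _); apply/seteqP; split => o [].
  by apply: (etrans E); rewrite ind// muleC.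
have mkE (g : Omega -> R) : (\int[P]_(o in A) (g o)%:E = \int[P]_o (\1_A o * g
  o)%:E)%E.
  rewrite integral_mkcond; apply: eq_integral => o _; rewrite patchE indicE.
  by case: (o \in A); rewrite ?mul1r ?mul0r.
rewrite mkE [leRHS]mkE.
have -> : (\int[P]_o (\1_A o * h o (X o))%:E = \int[distribution P pV]_p f p)%E.
  by rewrite ge0_integral_distribution.
rewrite -(eq_measure_integral _ (fun C mC _ => prodE C mC)).
rewrite fubini_tonelli1// ge0_integral_distribution//; last 2 first.
- exact: measurable_fun_fubini_tonelli_F.
- by move=> o; apply: integral_ge0.
apply: ge0_le_integral => //.
- by move=> o _; apply: integral_ge0.
- apply: measurableT_comp => //; exact: measurable_fun_fubini_tonelli_F.
- apply/measurable_EFinP; exact: measurable_funM.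
move=> o _; rewrite /fubini_F /= ge0_integral_distribution//=; last first.
  by apply: (measurableT_comp mf); exact: measurable_fun_pair.
rewrite /f /= indicE; case: (o \in A);
  under eq_integral do rewrite ?mul1r ?mul0r.
  by rewrite mul1r.
by rewrite mul0r integral0.
Qed.

Lemma ge0_integral_mrestr (R : realType) (d : measure_display)
    (T : measurableType d) (mu : {measure set T -> \bar R}) (E D : set T)
    (mE : measurable E) (f : T -> \bar R) :
  measurable D -> measurable_fun D f -> (forall x, D x -> (0 <= f x)%E) ->
  (\int[mrestr mu mE]_(x in D) f x = \int[mu]_(x in D `&` E) f x)%E.
Proof.
move=> mD mf f0; rewrite -[in LHS](setUIDK D E) ge0_integral_setU//.
- rewrite [X in (_ + X)%E](_ : _ = 0%E) ?adde0.
    by apply: eq_measure_integral => A mA AS;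
      rewrite /= /mrestr setIidl// => x /AS[].
  rewrite (eq_measure_integral mzero) ?integral_measure_zero// => A mA AS.
  rewrite /= /mrestr /mzero (_ : _ `&` _ = set0) ?measure0//.
  by apply/seteqP; split => x // -[/AS[]].
- exact: measurableI.
- exact: measurableD.
- by rewrite setUIDK.
- by rewrite setUIDK.
- by apply/disj_set2P; apply/seteqP; split => x // -[[_ ?] [_]].
Qed.

(** Both sides are integrals of [g] against images of measures under [X], and [uniform_index] says
    that these agree on subsets of [[set x | n x = m]]. *)
Lemma integral_uniform_index_cell (R : realType) (dO dX : measure_display)
    (Omega : measurableType dO) (Xi : measurableType dX)
    (P : probability Omega R) (n : Xi -> nat) (X : {RV P >-> Xi})
    (U : {RV P >-> nat}) (g : Xi -> R) (m u : nat) :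
  uniform_index n X U -> measurable [set x | n x = m] -> (u < m)%N ->
  measurable_fun setT g -> (forall x, 0 <= g x) ->
  (\int[P]_(o in [set o | n (X o) = m] `&` [set o | U o = u]) (g (X o))%:E =
   (m%:R^-1)%:E * \int[P]_(o in [set o | n (X o) = m]) (g (X o))%:E)%E.
Proof.
move=> [_ unif] mn um mg g0.
have mU : measurable [set o | U o = u].
  by rewrite -[X in measurable X]setTI;
    exact: (@measurable_funP _ _ _ _ setT U measurableT [set u]).
have mX : measurable_fun setT X by exact: measurable_funP.
have mXn : measurable [set o | n (X o) = m].
  by rewrite -[X in measurable X]setTI; exact: (mX measurableT _ mn).
have mgE (D : set Xi) : measurable_fun D (EFin \o g).
  by apply: measurable_funTS; exact/measurable_EFinP.
have mgX (D : set Omega) : measurable_fun D (fun o => (g (X o))%:E : \bar R).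
  by apply: measurable_funTS; apply/measurable_EFinP; exact: measurableT_comp.
rewrite -(ge0_integral_mrestr P mU) //; last by move=> o _; rewrite lee_fin.
have c0 : 0 <= m%:R^-1 :> R by rewrite invr_ge0.
have H1 := @ge0_integral_pushforward _ _ _ _ R X mX (mrestr P mU) _ (EFin \o g)
  mn (mgE _) (fun y _ => g0 y : (0 <= (g y)%:E)%E).
have H2 := @ge0_integral_pushforward _ _ _ _ R X mX P _ (EFin \o g) mn (mgE _)
  (fun y _ => g0 y : (0 <= (g y)%:E)%E).
rewrite -[LHS]H1 -[X in (_ * X)%E]H2 -(@ge0_integral_mscale _ _ _ _ _ mn (NngNum
  c0))//.
apply: eq_measure_integral => A mA AS.
rewrite /= /mscale /= /pushforward /mrestr /=.
transitivity (P [set o | [/\ A (X o), n (X o) = m & U o = u]]).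
  by congr (P _); apply/seteqP; split => o /= => [[Ao Uo]|[Ao nm Uo]] //;
    split => //; exact: AS.
rewrite unif//; congr (_ * P _)%E.
by apply/seteqP; split => o /= => [[]//|Ao]; split => //; exact: AS.
by move=> x _; rewrite lee_fin.
Qed.

(** [psi] dominates the average of [h] over the admissible indices. The space is cut by the value of
    [n X] and then by the index. *)
Lemma integral_uniform_index_le (R : realType) (dO dX : measure_display)
    (Omega : measurableType dO) (Xi : measurableType dX)
    (P : probability Omega R) (n : Xi -> nat) (X : {RV P >-> Xi})
    (U : {RV P >-> nat}) (h : Xi -> nat -> R) (psi : Xi -> R) :
  uniform_index n X U -> (forall m, measurable [set x | n x = m]) ->
  (forall u, measurable_fun setT (h^~ u)) -> (forall x u, 0 <= h x u) ->
  measurable_fun setT psi -> (forall x, 0 <= psi x) ->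
  (forall x u, n x = 0%N -> h x u <= psi x) ->
  (forall x, \sum_(u < n x) h x u <= (n x)%:R * psi x) ->
  (\int[P]_o (h (X o) (U o))%:E <= \int[P]_o (psi (X o))%:E)%E.
Proof.
move=> unif mn mh h0 mpsi psi0 hpsi0 hpsi.
have mU u : measurable [set o | U o = u].
  by rewrite -[X in measurable X]setTI;
    exact: (@measurable_funP _ _ _ _ setT U measurableT [set u]).
have mX : measurable_fun setT X by exact: measurable_funP.
have mXn m : measurable [set o | n (X o) = m].
  by rewrite -[X in measurable X]setTI; exact: (mX measurableT _ (mn m)).
have mhXU : measurable_fun setT (fun o => h (X o) (U o)).
  have mh' : measurable_fun setT (fun p : Xi * nat => h p.1 p.2).
    exact: measurable_fun_prod_nat.
  apply: (measurableT_comp mh' (measurable_fun_pair mX _)).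
  exact: measurable_funP.
have mEh (D : set Omega) : measurable_fun D (fun o => (h (X o) (U o))%:E : \bar
  R).
  by apply: measurable_funTS; apply/measurable_EFinP.
have mEpsi (D : set Omega) : measurable_fun D (fun o => (psi (X o))%:E : \bar
  R).
  by apply: measurable_funTS; apply/measurable_EFinP;
    exact: measurableT_comp mpsi mX.
have mEu (D : set Omega) u : measurable_fun D (fun o => (h (X o) u)%:E : \bar
  R).
  by apply: measurable_funTS; apply/measurable_EFinP;
    exact: measurableT_comp (mh u) mX.
have TE : [set: Omega] = \bigcup_m [set o | n (X o) = m].
  by apply/seteqP; split => o // _; exists (n (X o)).
have triv : trivIset setT (fun m => [set o | n (X o) = m]).
  by apply/trivIsetP => i j _ _ ij; apply/seteqP; split => o //= [->] /eqP;
    rewrite (negbTE ij).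
rewrite TE ge0_integral_bigcup//; last by move=> o _; rewrite lee_fin.
rewrite [leRHS]ge0_integral_bigcup//; last by move=> o _; rewrite lee_fin.
apply: lee_nneseries => [m _ _|m _]; first by apply: integral_ge0 => o _;
  rewrite lee_fin.
(* Without admissible indices [U] is arbitrary and there is nothing to average, so the pointwise
   bound is used. *)
case: m => [|m].
  apply: ge0_le_integral => //; first by move=> o _; rewrite lee_fin.
  by move=> o /= nm; rewrite lee_fin hpsi0.
have mE : [set o | n (X o) = m.+1] =
    \big[setU/set0]_(u <- index_iota 0 m.+1) ([set o | n (X o) = m.+1] `&` [set
      o | U o = u]).
  rewrite -bigcup_seq; apply/seteqP; split => o /=; last by move=> [u _ []].
  move=> nm; exists (U o) => //=; rewrite mem_index_iota /= -nm.
  by case: unif => + _; apply; rewrite nm.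
rewrite [X in (\int[P]_(_ in X) _ <= _)%E]mE ge0_integral_bigsetU//;
  last 4 first.
- by move=> u; exact: measurableI.
- exact: iota_uniq.
- apply/trivIsetP => i j _ _ ij; apply/seteqP; split => o //= [[_ ->] [_ /eqP]].
  by rewrite (negbTE ij).
- by move=> o _; rewrite lee_fin.
apply: (@le_trans _ _ (\sum_(u <- index_iota 0 m.+1) (m.+1%:R^-1)%:E *
    \int[P]_(o in [set o | n (X o) = m.+1]) (h (X o) u)%:E)%E).
  rewrite le_eqVlt; apply/orP; left; apply/eqP.
  rewrite big_seq [RHS]big_seq; apply: eq_bigr => u;
    rewrite mem_index_iota /= => um.
  rewrite -(@integral_uniform_index_cell _ _ _ _ _ P n X U (h^~ u) _ _ unif (mn
    _) um (mh u))//.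
  by apply: eq_integral => o; rewrite inE /= => -[_ ->].
rewrite -ge0_sume_distrr; last first.
  by move=> u _; apply: integral_ge0 => o _; rewrite lee_fin.
rewrite -ge0_integral_sum//; last by move=> u o _; rewrite lee_fin.
rewrite -ge0_integralZl_EFin//; last 2 first.
- by move=> o _; rewrite sume_ge0// => u _; rewrite lee_fin.
- exact: emeasurable_sum.
apply: ge0_le_integral => //.
- by move=> o _; rewrite mule_ge0 ?lee_fin// sume_ge0// => u _; rewrite lee_fin.
- by apply: measurable_funeM; exact: emeasurable_sum.
move=> o /= nm; rewrite sumEFin -EFinM lee_fin mulrC ler_pdivrMr// mulrC.
by have := hpsi (X o); rewrite nm big_mkord.
Qed.

Lemma integrable_EFinD (R : realType) (d : measure_display)
    (T : measurableType d) (P : probability T R) (f g : T -> R) :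
  P.-integrable setT (EFin \o f) -> P.-integrable setT (EFin \o g) ->
  P.-integrable setT (EFin \o (fun o => f o + g o)).
Proof. by move=> hf hg; have := integrableD measurableT hf hg. Qed.

Lemma integrable_EFinZ (R : realType) (d : measure_display)
    (T : measurableType d) (P : probability T R) (c : R) (f : T -> R) :
  P.-integrable setT (EFin \o f) ->
  P.-integrable setT (EFin \o (fun o => c * f o)).
Proof. by move=> hf; have := integrableZl measurableT c hf. Qed.

Lemma integrable_EFin_cst (R : realType) (d : measure_display)
    (T : measurableType d) (P : probability T R) (c : R) :
  P.-integrable setT (EFin \o (fun=> c : R)).
Proof. exact: finite_measure_integrable_cst. Qed.

Lemma Rintegral_cst_prob (R : realType) (d : measure_display)
    (T : measurableType d) (P : probability T R) (c : R) :
  \int[P]_o c = c.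
Proof.
rewrite /Rintegral integral_cst//.
rewrite [X in (_ * X)%E](_ : _ = 1%E) ?mule1//.
exact: probability_setT.
Qed.

Lemma Rintegral_le (R : realType) (d : measure_display)
    (T : measurableType d) (P : probability T R) (f g : T -> R) :
  P.-integrable setT (EFin \o f) -> P.-integrable setT (EFin \o g) ->
  (forall o, f o <= g o) -> \int[P]_o f o <= \int[P]_o g o.
Proof. by move=> hf hg fg; apply: le_Rintegral. Qed.

Lemma integrable_dot (R : realType) (dT : measure_display)
    (T : measurableType dT) (P : probability T R) (d : nat) (a : 'cV[R]_d)
    (V : T -> 'cV[R]_d) :
  (forall i, P.-integrable setT (EFin \o (fun o => V o i 0))) ->
  P.-integrable setT (EFin \o (fun o => dot a (V o))).
Proof.
move=> iV.
have : P.-integrable setT (fun o => (\sum_(i < d) (a i 0 * V o i 0)%R%:E)%E).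
  by apply: integrable_sum => // i _; apply: integrable_EFinZ.
by apply: eq_integrable => // o _; rewrite /= sumEFin.
Qed.

Lemma Rintegral_dot (R : realType) (dT : measure_display)
    (T : measurableType dT) (P : probability T R) (d : nat) (a b : 'cV[R]_d)
    (V : T -> 'cV[R]_d) :
  (forall i, P.-integrable setT (EFin \o (fun o => V o i 0))) ->
  (forall i, \int[P]_o V o i 0 = b i 0) ->
  \int[P]_o dot a (V o) = dot a b.
Proof.
move=> iV bV.
rewrite /Rintegral.
under eq_integral do rewrite /dot -sumEFin.
rewrite (@integral_sum _ _ _ _ _ _ _ (fun i o => (a i 0 * V o i 0)%:E))//;
  last first.
  by move=> i; apply: integrable_EFinZ.
have fin i : (\int[P]_o (a i 0 * V o i 0)%:E = (a i 0 * b i 0)%:E)%E.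
  rewrite -bV -RintegralZl// /Rintegral fineK//.
  by apply: integrable_fin_num => //; apply: integrable_EFinZ.
by under eq_bigr do rewrite fin; rewrite sumEFin.
Qed.

Section Expectations.
Context (R : realType) (dO dX : measure_display)
  (Omega : measurableType dO) (Xi : measurableType dX)
  (P : probability Omega R) (d : nat)
  (f : Xi -> 'cV[R]_d -> R) (xi : {RV P >-> Xi})
  (mu L : R) (wstar : 'cV[R]_d)
  (f_diff : forall x v, differentiable (f x) v)
  (f_meas : forall v, measurable_fun setT (fun x => f x v))
  (f_int : forall v, P.-integrable setT (fun o => (f (xi o) v)%:E))
  (f_unbiased : unbiased_gradient P f xi)
  (mu_gt0 : 0 < mu)
  (F_sc : strongly_convex mu (objective P f xi))
  (L_gt0 : 0 < L)
  (f_smooth : forall x, smooth L (f x))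
  (f_convex : forall x, grad_convex (f x))
  (wstar_min : is_minimizer (objective P f xi) wstar)
  (N_fin : (2%R%:E * 'E_P[fun o => (enorm (grad (f (xi o)) wstar) ^+ 2)%R] <
    +oo)%E).

Let F := objective P f xi.

Lemma Rintegral_objective v : \int[P]_o f (xi o) v = F v.
Proof. by rewrite /F /objective unlock. Qed.

Lemma integrable_grad v i :
  P.-integrable setT (EFin \o (fun o => grad (f (xi o)) v i 0)).
Proof. by have [_ /(_ i)[]] := f_unbiased v. Qed.

Lemma Rintegral_grad v i : \int[P]_o grad (f (xi o)) v i 0 = grad F v i 0.
Proof. by have [_ /(_ i)[_]] := f_unbiased v;
  rewrite unlock /Rintegral => ->. Qed.

Lemma measurable_grad_sqr v :
  measurable_fun setT (fun x => dot (grad (f x) v) (grad (f x) v)).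
Proof.
by apply: measurable_sum => i; apply: measurable_funM; exact: measurable_grad.
Qed.

Lemma integrable_grad_sqr_star : P.-integrable setT
  (EFin \o (fun o => dot (grad (f (xi o)) wstar) (grad (f (xi o)) wstar))).
Proof.
apply/integrableP; split.
  apply/measurable_EFinP; apply: (measurableT_comp (measurable_grad_sqr wstar)).
  exact: measurable_funP.
rewrite (_ : (\int[P]_o _)%E = 'E_P[fun o => (enorm (grad (f (xi o)) wstar) ^+
  2)%R]%E).
  have := N_fin; case: ('E_P[_])%E => [r| |] //=; first by rewrite !ltry.
  by rewrite gt0_muley ?lte_fin// ltxx.
rewrite unlock; apply: eq_integral => o _ /=.
by rewrite enorm_sqr ger0_norm ?dot_ge0.
Qed.

(** The quantity [N] of the theorem, as a real number. *)
Definition grad_noise : R :=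
  2 * \int[P]_o dot (grad (f (xi o)) wstar) (grad (f (xi o)) wstar).

Lemma grad_objective_star : grad F wstar = 0.
Proof. by apply: grad_minimizer wstar_min; have [] := f_unbiased wstar. Qed.

Let gap v o := grad (f (xi o)) v - grad (f (xi o)) wstar.

(** Co-coercivity gives the integrable majorant [b]; its linear term has mean zero because the
    gradient of [F] vanishes at [wstar]. *)
Lemma integrable_gap_sqr v :
  P.-integrable setT (EFin \o (fun o => dot (gap v o) (gap v o))) /\
  \int[P]_o dot (gap v o) (gap v o) <= 4 * L * (F v - F wstar).
Proof.
have fi u : P.-integrable setT (EFin \o (fun o => f (xi o) u)) := f_int u.
pose b o := 4 * L * (f (xi o) v + (-1 * f (xi o) wstar +
  dot (wstar - v) (grad (f (xi o)) wstar))).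
have ib0 : P.-integrable setT (EFin \o (fun o => dot (wstar - v) (grad (f (xi
  o)) wstar))).
  by apply: integrable_dot => i; exact: integrable_grad.
have ib1 : P.-integrable setT (EFin \o (fun o => -1 * f (xi o) wstar)).
  exact: integrable_EFinZ.
have ib2 := integrable_EFinD ib1 ib0.
have ib3 := integrable_EFinD (fi v) ib2.
have ib : P.-integrable setT (EFin \o b) by exact: integrable_EFinZ.
have gb o : dot (gap v o) (gap v o) <= b o.
  apply: le_trans (cocoercive v wstar L_gt0 (f_smooth _) (f_convex _)) _.
  by rewrite /b [dot (wstar - v) _]dotC -[wstar - v]opprB dotNr mulN1r addrA.
have mgi i : measurable_fun setT (fun o => gap v o i 0).
  apply: (eq_measurable_fun (fun o =>
    grad (f (xi o)) v i 0 - grad (f (xi o)) wstar i 0 : R)).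
    by move=> o _; rewrite !mxE.
  by apply: measurable_funB;
    apply: (measurableT_comp (measurable_grad _ _ f_diff f_meas));
    exact: measurable_funP.
have mg : measurable_fun setT (fun o => dot (gap v o) (gap v o)).
  by apply: measurable_sum => i; apply: measurable_funM.
have ig : P.-integrable setT (EFin \o (fun o => dot (gap v o) (gap v o))).
  apply: (le_integrable measurableT _ _ ib); first exact/measurable_EFinP.
  move=> o _; rewrite /= lee_fin !ger0_norm ?dot_ge0//.
  exact: le_trans (dot_ge0 _) (gb o).
split => //; apply: le_trans (Rintegral_le ig ib gb) _.
rewrite /b RintegralZl// RintegralD// RintegralD// RintegralZl//.
rewrite !Rintegral_objective (@Rintegral_dot _ _ _ _ _ _ (grad F wstar));
  last 2 first.
- by move=> i; exact: integrable_grad.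
- by move=> i; exact: Rintegral_grad.
by rewrite grad_objective_star dot0r addr0 mulN1r.
Qed.

(** Jensen's inequality for the mean [grad F v] of the gap, obtained by integrating Young's
    inequality against that fixed vector. *)
Lemma grad_objective_sqr_le v :
  dot (grad F v) (grad F v) <= \int[P]_o dot (gap v o) (gap v o).
Proof.
have [ig _] := integrable_gap_sqr v.
have iv i : P.-integrable setT (EFin \o (fun o => gap v o i 0)).
  have := integrable_EFinD (integrable_grad v i) (integrable_EFinZ (-1)
    (integrable_grad wstar i)).
  by apply: eq_integrable => // o _ /=; rewrite !mxE mulN1r.
have Ev i : \int[P]_o gap v o i 0 = grad F v i 0.
  transitivity (\int[P]_o (grad (f (xi o)) v i 0 + -1 * grad (f (xi o)) wstar i
    0)).
    by apply: eq_Rintegral => o _; rewrite !mxE mulN1r.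
  rewrite RintegralD//;
    [|exact: integrable_grad|exact/integrable_EFinZ/integrable_grad].
  rewrite RintegralZl//; last exact: integrable_grad.
  by rewrite !Rintegral_grad grad_objective_star [X in _ * X]mxE mulr0 addr0.
have id := integrable_dot (grad F v) iv.
have := @Rintegral_le _ _ _ P (fun o => 2 * dot (grad F v) (gap v o))
   (fun o => dot (grad F v) (grad F v) + dot (gap v o) (gap v o)).
rewrite RintegralZl// RintegralD//; last exact: integrable_EFin_cst.
rewrite Rintegral_cst_prob (@Rintegral_dot _ _ _ _ _ _ (grad F v))// => h.
suff : 2 * dot (grad F v) (grad F v) <= dot (grad F v) (grad F v) + \int[P]_o
  dot (gap v o) (gap v o) by lra.
apply: h; first exact: integrable_EFinZ.
  by apply: integrable_EFinD => //; exact: integrable_EFin_cst.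
by move=> o; have := dot_young (grad F v) (gap v o) ltr01; rewrite invr1 !mul1r.
Qed.

(** The gradient is the gap plus the gradient at [wstar]. Squaring costs a factor 2 on each part,
    whence [8 * L] and the 2 inside [grad_noise]. *)
Lemma grad_sqr_moment v : P.-integrable setT
    (EFin \o (fun o => dot (grad (f (xi o)) v) (grad (f (xi o)) v))) /\
  \int[P]_o dot (grad (f (xi o)) v) (grad (f (xi o)) v) <=
    8 * L * (F v - F wstar) + grad_noise.
Proof.
have [ig hg] := integrable_gap_sqr v; have istar := integrable_grad_sqr_star.
pose b o := 2 * dot (gap v o) (gap v o) +
  2 * dot (grad (f (xi o)) wstar) (grad (f (xi o)) wstar).
have ib1 := integrable_EFinZ 2 ig; have ib2 := integrable_EFinZ 2 istar.
have ib : P.-integrable setT (EFin \o b) by exact: integrable_EFinD.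
have gb o : dot (grad (f (xi o)) v) (grad (f (xi o)) v) <= b o.
  by have := dot_sqrD (gap v o) (grad (f (xi o)) wstar); rewrite /gap subrK.
have im : P.-integrable setT
    (EFin \o (fun o => dot (grad (f (xi o)) v) (grad (f (xi o)) v))).
  apply: (le_integrable measurableT _ _ ib).
    apply/measurable_EFinP; apply: (measurableT_comp (measurable_grad_sqr v)).
    exact: measurable_funP.
  move=> o _; rewrite /= lee_fin !ger0_norm ?dot_ge0//.
  exact: le_trans (dot_ge0 _) (gb o).
split => //; apply: le_trans (Rintegral_le im ib gb) _.
by rewrite RintegralD// !RintegralZl// /grad_noise lerD2r; lra.
Qed.

Lemma expected_drift (w what : 'cV[R]_d) (eta c : R) :
  0 <= eta -> 0 <= c -> c * (8 * L) <= eta ->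
  let psi o := dot (w - wstar) (w - wstar)
     - 2 * eta * dot (w - wstar) (grad (f (xi o)) what)
     + c * dot (grad (f (xi o)) what) (grad (f (xi o)) what) in
  P.-integrable setT (EFin \o psi) /\
  \int[P]_o psi o <= (1 - eta * mu / 2) * dot (w - wstar) (w - wstar)
    + (4 * L + mu) * eta * dot (w - what) (w - what) + c * grad_noise.
Proof.
move=> eta0 c0 ceta psi.
have [im hm] := grad_sqr_moment what; have [_ hg] := integrable_gap_sqr what.
have hp := grad_objective_sqr_le what.
have i1 : P.-integrable setT (EFin \o (fun o => dot (w - wstar) (grad (f (xi o))
  what))).
  by apply: integrable_dot => i; exact: integrable_grad.
have i2 := integrable_EFinZ (- (2 * eta)) i1.
have i3 := integrable_EFinD (integrable_EFin_cst P (dot (w - wstar) (w -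
  wstar))) i2.
have i4 := integrable_EFinZ c im.
have psiE o : psi o = dot (w - wstar) (w - wstar)
     + (- (2 * eta)) * dot (w - wstar) (grad (f (xi o)) what)
     + c * dot (grad (f (xi o)) what) (grad (f (xi o)) what) by rewrite /psi
       mulNr.
split.
  by have := integrable_EFinD i3 i4; apply: eq_integrable => // o _;
    rewrite /= psiE.
under eq_Rintegral do rewrite psiE.
rewrite RintegralD// RintegralD//; last exact: integrable_EFin_cst.
rewrite !RintegralZl// Rintegral_cst_prob (@Rintegral_dot _ _ _ _ _ _ (grad F
  what)); last 2 first.
- by move=> i; exact: integrable_grad.
- by move=> i; exact: Rintegral_grad.
have := F_sc wstar what; rewrite -/F enorm_sqr.
move: hm hg hp; set p := grad F what; set m2 := (X in X <= _ -> _).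
set G2 := \int[P]_o dot (gap what o) (gap what o); set N := grad_noise.
move=> hm hg hp sc.
have c40 : 0 < (4 * L)^-1 by rewrite invr_gt0 mulr_gt0.
(* Strong convexity is applied at the read vector, while the distance to control is that of [w].
   With this Young constant the correction costs only one of the two copies of [Del] that strong
   convexity provides; the other is kept for the squared gradient. *)
have := dot_young p (what - w) c40; rewrite invrK => yg.
have sq := dot_sqrD (what - wstar) (w - what).
have wE : what - wstar + (w - what) = w - wstar by rewrite addrC addrA subrK.
rewrite wE in sq.
have ba : dot (wstar - what) (wstar - what) = dot (what - wstar) (what - wstar).
  by rewrite -opprB dotNl dotNr opprK.
have bp : dot p (wstar - what) = - dot p (what - wstar) by rewrite -dotNr opprB.
have bw : dot p (what - w) = - dot p (w - what) by rewrite -dotNr opprB.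
have be : dot (what - w) (what - w) = dot (w - what) (w - what).
  by rewrite -opprB dotNl dotNr opprK.
have ap : dot (w - wstar) p = dot p (what - wstar) + dot p (w - what).
  by rewrite dotC -wE dotDr.
rewrite ba bp in sc; rewrite bw be in yg; rewrite ap.
move: sc yg sq; set A := dot (w - wstar) (w - wstar).
set B := dot (what - wstar) (what - wstar); set e := dot (w - what) (w - what).
set x := dot p (what - wstar); set y := dot p (w - what) => sc yg sq.
have [Del DelE] : {Del | Del = F what - F wstar} by exists (F what - F wstar).
rewrite -DelE in hm hg.
have Del0 : 0 <= Del.
  have : 0 <= 4 * L * Del by apply: le_trans hg; apply: le_trans hp;
    exact: dot_ge0.
  by rewrite pmulr_rge0// mulr_gt0.
have h1 : (4 * L)^-1 * dot p p <= Del.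
  rewrite mulrC ler_pdivrMr ?mulr_gt0// mulrC; exact: le_trans hp hg.
have h2 : 2 * - y <= Del + 4 * L * e by lra.
have h3 : Del + mu / 2 * B <= x by lra.
have h4 : mu * A <= mu * (2 * B + 2 * e) by rewrite ler_pM2l.
have h5 : - (2 * (x + y)) <= - Del - mu / 2 * A + (4 * L + mu) * e by lra.
have h6 : eta * - (2 * (x + y)) <= eta * (- Del - mu / 2 * A + (4 * L + mu) *
  e).
  exact: ler_wpM2l.
(* The second moment costs [c * (8 * L) * Del], which the remaining [eta * Del] absorbs by the
   assumption on [c]. *)
have h7 : c * m2 <= c * (8 * L * Del + N) by exact: ler_wpM2l.
have h8 : c * (8 * L) * Del <= eta * Del by exact: ler_wpM2r.
rewrite -subr_ge0; move: h6 h7 h8; rewrite -subr_ge0 => h6;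
  rewrite -subr_ge0 => h7.
rewrite -subr_ge0 => h8; apply: le_trans (addr_ge0 (addr_ge0 h6 h7) h8) _.
by rewrite -/m2 le_eqVlt; apply/orP; left; apply/eqP; field.
Qed.

End Expectations.

(** * The filtered update and its one-step inequality *)

Definition update (R : realType) (X : Type) (d D : nat)
    (f : X -> 'cV[R]_d -> R) (S : X -> nat -> 'M[R]_d) (p : X * nat)
    (v : 'cV[R]_d) : 'cV[R]_d :=
  \col_i (filter_coef D f S i p * grad (f p.1) v i 0).

Lemma update_filter (R : realType) (X : Type) (d D : nat)
    (f : X -> 'cV[R]_d -> R) (S : X -> nat -> 'M[R]_d) x u v :
  is_filter_family D (f x) (S x) -> (u < nfilters D (f x))%N ->
  update D f S (x, u) v = (nfilters D (f x))%:R *: (S x u *m grad (f x) v).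
Proof.
move=> [+ _ _] un => /(_ u un)[mS _ _]; apply/matrixP => i j.
by rewrite ord1 [LHS]mxE [RHS]mxE mask_mulE// /filter_coef /= un mulrA.
Qed.

Lemma update_nofilter (R : realType) (X : Type) (d D : nat)
    (f : X -> 'cV[R]_d -> R) (S : X -> nat -> 'M[R]_d) x u v :
  nfilters D (f x) = 0%N -> update D f S (x, u) v = 0.
Proof.
by move=> n0; apply/matrixP => i j;
  rewrite [LHS]mxE [RHS]mxE /filter_coef /= n0 mul0r.
Qed.

(** An empty sum of filters still acts as the identity on gradients. *)
Lemma grad_nofilter (R : realType) (d D : nat) (g : 'cV[R]_d -> R)
    (S : nat -> 'M[R]_d) v :
  is_filter_family D g S -> nfilters D g = 0%N -> grad g v = 0.
Proof.
move=> fS n0; apply/matrixP => i j; rewrite ord1 [RHS]mxE.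
rewrite -(sum_filter_diag v i fS) (_ : \sum_(u < _) _ = 0) ?mul0r//.
by apply: big1 => u; have := ltn_ord u; rewrite {2}n0.
Qed.

Lemma measurable_dot (R : realType) (dT : measure_display)
    (T : measurableType dT) (d : nat) (V W : T -> 'cV[R]_d) :
  (forall i, measurable_fun setT (fun t => V t i 0)) ->
  (forall i, measurable_fun setT (fun t => W t i 0)) ->
  measurable_fun setT (fun t => dot (V t) (W t)).
Proof.
by move=> mV mW; apply: measurable_sum => i; apply: measurable_funM.
Qed.

Lemma same_law_integral (R : realType) (dO dX : measure_display)
    (Omega : measurableType dO) (Xi : measurableType dX)
    (P : probability Omega R) (X Y : {RV P >-> Xi}) (g : Xi -> R) :
  same_law X Y -> measurable_fun setT g -> (forall x, 0 <= g x) ->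
  (\int[P]_o (g (X o))%:E = \int[P]_o (g (Y o))%:E)%E.
Proof.
move=> XY mg g0.
have mE : measurable_fun setT (EFin \o g) by exact/measurable_EFinP.
have gE0 x : (0 <= (EFin \o g) x)%E by rewrite lee_fin.
rewrite -[LHS](ge0_integral_distribution X mE gE0).
rewrite -[RHS](ge0_integral_distribution Y mE gE0).
by apply: eq_measure_integral => A mA _; exact: XY.
Qed.

(* v is the vector read from memory; k is the weight with which the update enters
   the discounted sum of the potential. *)
Definition step_energy (R : realType) (X : Type) (d D : nat)
    (f : X -> 'cV[R]_d -> R) (S : X -> nat -> 'M[R]_d) (wstar : 'cV[R]_d)
    (e k : R) (w v : 'cV[R]_d) (p : X * nat) : R :=
  let G := update D f S p v in
  dot (w - wstar - e *: G) (w - wstar - e *: G) + k * dot G G.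

Section OneStep.
Context (R : realType) (dO dX : measure_display)
  (Omega : measurableType dO) (Xi : measurableType dX)
  (P : probability Omega R) (d : nat)
  (f : Xi -> 'cV[R]_d -> R) (xi : {RV P >-> Xi})
  (mu L : R) (wstar : 'cV[R]_d) (D : nat) (S : Xi -> nat -> 'M[R]_d)
  (f_diff : forall x v, differentiable (f x) v)
  (f_meas : forall v, measurable_fun setT (fun x => f x v))
  (f_int : forall v, P.-integrable setT (fun o => (f (xi o) v)%:E))
  (f_unbiased : unbiased_gradient P f xi)
  (mu_gt0 : 0 < mu)
  (F_sc : strongly_convex mu (objective P f xi))
  (L_gt0 : 0 < L)
  (f_smooth : forall x, smooth L (f x))
  (f_convex : forall x, grad_convex (f x))
  (wstar_min : is_minimizer (objective P f xi) wstar)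
  (N_fin : (2%R%:E * 'E_P[fun o => (enorm (grad (f (xi o)) wstar) ^+ 2)%R] <
    +oo)%E)
  (S_filters : forall x, is_filter_family D (f x) (S x))
  (S_meas : forall u a b,
    measurable_fun [set x | (u < nfilters D (f x))%N] (fun x => S x u a b)).

Lemma step_energy_ge0 e k w v p :
  0 <= k -> 0 <= step_energy D f S wstar e k w v p.
Proof. by move=> k0; rewrite addr_ge0 ?mulr_ge0 ?dot_ge0. Qed.

Lemma measurable_update_comp (dT : measure_display) (T : measurableType dT)
    (p : T -> Xi * nat) (V : T -> 'cV[R]_d) i :
  measurable_fun setT p -> (forall i, measurable_fun setT (fun t => V t i 0)) ->
  measurable_fun setT (fun t => update D f S (p t) (V t) i 0).
Proof.
move=> mp mV.
apply: (eq_measurable_fun (fun t => filter_coef D f S i (p t) * grad (f (p t).1)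
  (V t) i 0 : R)).
  by move=> t _; rewrite [RHS]mxE.
apply: measurable_funM.
  exact: (measurableT_comp (measurable_filter_coef i f_diff f_meas f_smooth
    S_meas) mp).
apply: (@measurable_comp_lipschitz _ _ _ _ _ _ (fun x v => grad (f x) v i 0) L
  (fun t => (p t).1)) => //.
- by move=> v; exact: measurable_grad.
- by move=> x v v'; exact: grad_lipschitz.
- exact: (measurableT_comp measurable_fst mp).
Qed.

Lemma measurable_step_energy (dT : measure_display) (T : measurableType dT)
    (p : T -> Xi * nat) (W V : T -> 'cV[R]_d) e k :
  measurable_fun setT p ->
  (forall i, measurable_fun setT (fun t => W t i 0)) ->
  (forall i, measurable_fun setT (fun t => V t i 0)) ->
  measurable_fun setT (fun t => step_energy D f S wstar e k (W t) (V t) (p t)).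
Proof.
move=> mp mW mV; have mG i := measurable_update_comp i mp mV.
have mD i : measurable_fun setT (fun t => (W t - wstar - e *: update D f S (p t)
  (V t)) i 0).
  apply: (eq_measurable_fun (fun t => W t i 0 - wstar i 0 - e * update D f S (p
    t) (V t) i 0 : R)).
    by move=> t _; move: (update _ _ _ _ _) => g; rewrite !mxE.
  apply: measurable_funB; first exact: measurable_funB.
  by apply: measurable_funM.
apply: measurable_funD; first exact: measurable_dot.
apply: measurable_funM => //; exact: measurable_dot.
Qed.

(** Averaging over the index first leaves [psi] of the sample, with the number of filters bounded by
    [D]; the law of the sample is then that of [xi], and [expected_drift] applies with
    [c = (e ^+ 2 + k) * D%:R]. *)
Lemma expected_step (X : {RV P >-> Xi}) (U : {RV P >-> nat}) (e k : R)
    (w v : 'cV[R]_d) :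
  same_law X xi -> uniform_index (fun x => nfilters D (f x)) X U ->
  0 <= e -> 0 <= k -> (e ^+ 2 + k) * D%:R * (8 * L) <= e ->
  (\int[P]_o (step_energy D f S wstar e k w v (X o, U o))%:E <=
   ((1 - e * mu / 2) * dot (w - wstar) (w - wstar)
    + (4 * L + mu) * e * dot (w - v) (w - v)
    + (e ^+ 2 + k) * D%:R * grad_noise f xi wstar)%:E)%E.
Proof.
move=> lawX unif e0 k0 hc; set c := (e ^+ 2 + k) * D%:R in hc *.
have ek0 : 0 <= e ^+ 2 + k by rewrite addr_ge0// sqr_ge0.
have c0 : 0 <= c by rewrite mulr_ge0.
pose psi x := dot (w - wstar) (w - wstar)
     - 2 * e * dot (w - wstar) (grad (f x) v)
     + c * dot (grad (f x) v) (grad (f x) v).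
pose h x u := step_energy D f S wstar e k w v (x, u).
have mpsi : measurable_fun setT psi.
  apply: measurable_funD; last first.
    by apply: measurable_funM => //; exact: measurable_grad_sqr.
  apply: measurable_funB => //; apply: measurable_funM => //.
  by apply: measurable_dot => // i; exact: measurable_grad.
have mh u : measurable_fun setT (h^~ u).
  by apply: measurable_step_energy => //; exact: measurable_fun_pair.
have h0 x u : 0 <= h x u by exact: step_energy_ge0.
have hpsi0 x u : nfilters D (f x) = 0%N -> h x u <= psi x.
  move=> n0; rewrite /h /step_energy /psi update_nofilter//.
  by rewrite (grad_nofilter v (S_filters x) n0) scaler0 subr0 !dot0r !mulr0
    subr0.
have hpsi x : \sum_(u < nfilters D (f x)) h x u <= (nfilters D (f x))%:R * psi
  x.
  have := sum_filter_step v (w - wstar) e k (S_filters x) => /=.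
  under eq_bigr do rewrite -update_filter//.
  rewrite /h /step_energy => ->; rewrite ler_wpM2l// /psi lerD2l.
  rewrite ler_wpM2r ?dot_ge0// ler_wpM2l// ler_nat; exact: nfilters_le.
(* The sign of [psi] is not visible in its formula; it follows since [psi] dominates an average of
   nonnegative energies. *)
have psi0 x : 0 <= psi x.
  have [n0|n0] := posnP (nfilters D (f x)).
    exact: le_trans (h0 x 0%N) (hpsi0 x 0%N n0).
  have : 0 <= (nfilters D (f x))%:R * psi x by apply: le_trans (hpsi x);
    exact: sumr_ge0.
  by rewrite pmulr_rge0// ltr0n.
have mn m : measurable [set x | nfilters D (f x) = m] by exact:
  measurable_nfilters f_smooth.
apply: le_trans (integral_uniform_index_le unif mn mh h0 mpsi psi0 hpsi0 hpsi)
  _.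
rewrite (same_law_integral lawX)//.
have [ip hp] := expected_drift f_diff f_meas f_int f_unbiased mu_gt0 F_sc L_gt0
  f_smooth f_convex wstar_min N_fin w v e0 c0 hc.
by move: hp; rewrite -lee_fin /Rintegral fineK//; exact: integrable_fin_num.
Qed.

End OneStep.

(** * Sums over the delay window and stepsize sequences *)

Lemma dot_sum_le (R : realType) (d : nat) (I : Type) (s : seq I)
    (v : I -> 'cV[R]_d) :
  dot (\sum_(i <- s) v i) (\sum_(i <- s) v i) <=
    2 ^+ size s * \sum_(i <- s) dot (v i) (v i).
Proof.
(* Each use of [dot_sqrD] costs a factor 2; the constant is harmless because the windows have length
   at most [tau]. *)
elim: s => [|i s IH]; first by rewrite !big_nil mulr0 dot0r.
rewrite !big_cons /= exprS; apply: le_trans (dot_sqrD _ _) _.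
rewrite -mulrDr -mulrA ler_wpM2l// mulrDr lerD//.
by rewrite -[leLHS]mul1r ler_wpM2r ?dot_ge0// exprn_ege1 ?ler1n.
Qed.

Lemma cvg_inv_shift (R : realType) (k : R) :
  0 < k -> (fun n : nat => (k + n%:R)^-1) @ \oo --> 0.
Proof.
move=> k0; apply/cvgrPdist_lt => e e0;
  have [N _ hN] := near_infty_natSinv_lt (PosNum e0).
exists N.+1 => // -[//|n] /= nN; rewrite sub0r normrN.
have kn : 0 < k + n.+1%:R by rewrite ltr_wpDr.
rewrite ger0_norm ?invr_ge0 ?(ltW kn)//; apply: le_lt_trans (hN n nN).
by rewrite lef_pV2 ?posrE// lerDr ltW.
Qed.

Lemma dvg_inv_shift (R : realType) (c k : R) :
  0 < c -> 0 < k -> ~ cvgn (series (fun n : nat => c / (k + n%:R))).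
Proof.
move=> c0 k0 h; apply: (@dvg_harmonic R).
have kn n : 0 < k + n%:R by rewrite ltr_wpDr.
(* Comparison with the harmonic series: [k + n <= (k + 1) * (n + 1)]. *)
apply: (@series_le_cvg _ _ (fun n => (k + 1) / c * (c / (k + n%:R)))).
- by move=> n; rewrite invr_ge0.
- by move=> n; rewrite !mulr_ge0 ?invr_ge0 ?addr_ge0 ?(ltW c0) ?(ltW k0).
- move=> n; rewrite mulrA divfK ?gt_eqF// /harmonic.
  rewrite -[leLHS]mul1r ler_pdivrMr// mulrAC ler_pdivlMr// mul1r.
  rewrite -natr1; have := ler0n R n; nra.
exact: is_cvg_seriesZ h.
Qed.

Section DiscountedSum.
Context (R : realType) (x : nat -> R) (x0 : forall t, 0 <= x t).

(** This is the sum over [j < t] of [x j / 2 ^+ (t - 1 - j)]. It dominates the sum over a bounded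
    window up to a constant, and the half lost at each step is what the drift estimate spends. *)
Fixpoint discounted_sum (t : nat) : R :=
  if t is s.+1 then discounted_sum s / 2 + x s else 0.

Lemma discounted_sum_ge0 t : 0 <= discounted_sum t.
Proof. by elim: t => //= t IH; rewrite addr_ge0// divr_ge0. Qed.

Lemma discounted_sum_term j m : x j <= 2 ^+ m * discounted_sum (j + m).+1.
Proof.
elim: m => [|m IH]; first by rewrite addn0 expr0 mul1r /= lerDr divr_ge0//
  discounted_sum_ge0.
apply: (le_trans IH); rewrite exprSr addnS -mulrA ler_wpM2l ?exprn_ge0//.
rewrite [discounted_sum _.+2]/= mulrDr mulrCA divff// mulr1 lerDl mulr_ge0//.
Qed.

(** A term of the window has been halved fewer than [tau] times. *)
Lemma window_sum_le (tau t : nat) :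
  \sum_((t - tau)%N <= j < t) x j <= tau%:R * 2 ^+ tau * discounted_sum t.
Proof.
apply: (@le_trans _ _ (\sum_((t - tau)%N <= j < t) 2 ^+ tau * discounted_sum
  t)).
  rewrite big_nat [leRHS]big_nat; apply: ler_sum => j /andP[j1 j2].
  have := discounted_sum_term j (t - j).-1.
  have -> : (j + (t - j).-1).+1 = t by lia.
  move/le_trans; apply; rewrite ler_wpM2r ?discounted_sum_ge0//.
  by rewrite ler_eXn2l ?ltr1n//; lia.
rewrite sumr_const_nat -[leLHS]mulr_natl -mulrA ler_wpM2r//.
  by rewrite mulr_ge0 ?exprn_ge0 ?discounted_sum_ge0.
by rewrite ler_nat; lia.
Qed.

End DiscountedSum.

(** * The recursion *)

Section Hogwild.
Context (R : realType) (dO dX : measure_display)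
  (Omega : measurableType dO) (Xi : measurableType dX)
  (P : probability Omega R) (d : nat)
  (f : Xi -> 'cV[R]_d -> R) (L : R) (wstar : 'cV[R]_d)
  (D : nat) (S : Xi -> nat -> 'M[R]_d) (tau : nat) (eta : nat -> R)
  (xis : nat -> {RV P >-> Xi}) (us : nat -> {RV P >-> nat})
  (Sigma : nat -> nat -> Omega -> 'M[R]_d)
  (w0 : 'cV[R]_d) (w what : nat -> Omega -> 'cV[R]_d)
  (f_diff : forall x v, differentiable (f x) v)
  (f_meas : forall v, measurable_fun setT (fun x => f x v))
  (f_smooth : forall x, smooth L (f x))
  (S_filters : forall x, is_filter_family D (f x) (S x))
  (S_meas : forall u a b,
    measurable_fun [set x | (u < nfilters D (f x))%N] (fun x => S x u a b))
  (us_unif : forall t,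
    uniform_index (fun x => nfilters D (f x)) (xis t) (us t))
  (Sigma_meas : forall t j a b, (t - tau <= j < t)%N ->
    measurable_fun setT (fun o => Sigma t j o a b))
  (eta_gt0 : forall t, 0 < eta t)
  (eta_decr : forall t, eta t.+1 <= eta t)
  (w_init : forall o, w 0%N o = w0)
  (w_step : hogwild_recursion f D S eta xis us w what)
  (what_consistent : consistent_memory f D S eta tau xis us Sigma w what).

Let G t o := update D f S (xis t o, us t o) (what t o).

(** If there are filters, the index is admissible; otherwise the scalar is zero, in agreement with
    the default value in [update]. *)
Lemma scaled_update t o :
  (nfilters D (f (xis t o)))%:R *: (S (xis t o) (us t o) *m grad (f (xis t o))
    (what t o)) = G t o.
Proof.
have [n0|n0] := posnP (nfilters D (f (xis t o))).
  by rewrite /G update_nofilter// n0 scale0r.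
by rewrite /G update_filter//; have [/(_ o n0)] := us_unif t.
Qed.

Lemma iterate_succ t o : w t.+1 o = w t o - eta t *: G t o.
Proof. by rewrite w_step -scalerA scaled_update. Qed.

Lemma read_vector t o : what t o = w (t - tau)%N o -
  \sum_((t - tau)%N <= j < t) eta j *: (Sigma t j o *m G j o).
Proof.
rewrite what_consistent.2; congr (_ - _); apply: eq_bigr => j _.
by rewrite -scaled_update -scalerA -mulmxA scalemxAr.
Qed.

Lemma iterate_telescope s t o : (s <= t)%N ->
  w t o = w s o - \sum_(s <= j < t) eta j *: G j o.
Proof.
elim: t => [|t IH]; first by rewrite leqn0 => /eqP ->; rewrite big_geq// subr0.
rewrite leq_eqVlt => /orP[/eqP ->|]; first by rewrite big_geq// subr0.
by rewrite ltnS => st; rewrite iterate_succ IH// big_nat_recr//= opprD addrA.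
Qed.

Lemma eta_mono s t : (s <= t)%N -> eta t <= eta s.
Proof.
by move=> /subnK <-; elim: (t - s)%N => // n IH; apply: le_trans IH;
  rewrite addSn.
Qed.

(** The cube combines the squared stepsize of an old update with the current stepsize, which is no
    larger. *)
Let x o t := eta t ^+ 3 * dot (G t o) (G t o).

Let x0 o t : 0 <= x o t.
Proof. by rewrite /x mulr_ge0 ?dot_ge0// exprn_ge0// ltW. Qed.

Definition delay_const : R := 2 ^+ tau * (tau%:R * 2 ^+ tau).

(** The iterate and the read differ only by what the masks removed from the updates of the last
    [tau] steps. *)
Lemma delay_error t o :
  eta t * dot (w t o - what t o) (w t o - what t o) <=
    delay_const * discounted_sum (x o) t.
Proof.
have -> : w t o - what t o =
    \sum_((t - tau)%N <= j < t) (- eta j) *: (G j o - Sigma t j o *m G j o).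
  rewrite read_vector (iterate_telescope o (leq_subr tau t)).
  rewrite opprB addrC addrA subrK -sumrB; apply: eq_bigr => j _.
  by rewrite -scalerBr scaleNr -scalerN opprB.
apply: (@le_trans _ _ (eta t * (2 ^+ tau * \sum_((t - tau)%N <= j < t)
    eta j ^+ 2 * dot (G j o) (G j o)))).
  rewrite ler_pM2l//; apply: le_trans (dot_sum_le _ _) _.
  apply: (@le_trans _ _ (2 ^+ size (index_iota (t - tau) t) *
      \sum_((t - tau)%N <= j < t) eta j ^+ 2 * dot (G j o) (G j o))).
    rewrite ler_wpM2l ?exprn_ge0// big_nat [leRHS]big_nat;
      apply: ler_sum => j jt.
    rewrite dotZl dotZr mulrA mulrNN -expr2 ler_wpM2l ?sqr_ge0//.
    by apply: mask_sub_le; exact: what_consistent.1.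
  rewrite ler_wpM2r//.
    by apply: sumr_ge0 => j _; rewrite mulr_ge0 ?sqr_ge0 ?dot_ge0.
  by rewrite size_iota ler_eXn2l ?ltr1n//; lia.
rewrite mulrCA /delay_const -[leRHS]mulrA ler_wpM2l ?exprn_ge0//.
apply: le_trans (window_sum_le (x0 o) tau t).
rewrite mulr_sumr big_nat [leRHS]big_nat; apply: ler_sum => j /andP[_ jt].
rewrite /x mulrA exprS ler_wpM2r ?dot_ge0// ler_wpM2r ?sqr_ge0//.
exact/eta_mono/ltnW.
Qed.

(** * Measurability of the iterates with respect to the history *)

Definition history_gen (t : nat) : set (set Omega) :=
  [set E | exists2 j, (j < t)%N &
         preimage_set_system setT (xis j) measurable E \/
         preimage_set_system setT (us j) measurable E] `|`
      [set E | exists s j a b,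
         [/\ (s <= t)%N, (s - tau <= j < s)%N &
             preimage_set_system setT (fun o => Sigma s j o a b)
               measurable E]].

Let T t : measurableType _ := g_sigma_algebraType (history_gen t).

Lemma history_measurable t : <<s history_gen t >> `<=` measurable.
Proof.
apply: smallest_sub; first exact: sigma_algebra_measurable.
move=> E [[j _ [] [A mA <-]]|[s [j [a [b [_ sj [A mA <-]]]]]]].
- exact: (@measurable_funP _ _ _ _ setT (xis j)).
- exact: (@measurable_funP _ _ _ _ setT (us j)).
- exact: (Sigma_meas a b sj measurableT).
Qed.

Lemma history_mono t : <<s history_gen t >> `<=` <<s history_gen t.+1 >>.
Proof.
apply: sub_sigma_algebra2 => E [[j jt h]|[s [j [a [b [st sj h]]]]]].
  by left; exists j => //; exact: ltnW.
by right; exists s, j, a, b; split => //; exact: leqW.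
Qed.

Lemma sample_adapted t j : (j < t)%N ->
  measurable_fun setT (fun o : T t => (xis j o, us j o)).
Proof.
move=> jt; apply: measurable_fun_pair => _ A mA; apply: sub_sigma_algebra; left.
  by exists j => //; left; exists A.
by exists j => //; right; exists A.
Qed.

Lemma mask_adapted t s j a b : (s <= t)%N -> (s - tau <= j < s)%N ->
  measurable_fun setT (fun o : T t => Sigma s j o a b).
Proof.
move=> st sj _ A mA; apply: sub_sigma_algebra; right.
by exists s, j, a, b; split => //; exists A.
Qed.

Lemma iterate_adapted t s : (s <= t)%N ->
  (forall i, measurable_fun setT (fun o : T t => w s o i 0)) /\
  (forall i, measurable_fun setT (fun o : T t => what s o i 0)).
Proof.
(* Strong induction, since the read at time [s] involves the updates, hence the reads, of all steps
   in its window. *)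
have [n] := ubnP s; elim: n s => // n IH s; rewrite ltnS => sn st.
have mG j i : (j < s)%N -> measurable_fun setT (fun o : T t => G j o i 0).
  move=> js; have jt := leq_trans js st.
  have [_ mwh] := IH j (leq_trans js sn) (ltnW jt).
  exact: (measurable_update_comp f_diff f_meas f_smooth S_meas i (sample_adapted
    jt) mwh).
have mw s' i : (s' <= s)%N -> measurable_fun setT (fun o : T t => w s' o i 0).
  rewrite leq_eqVlt => /orP[/eqP ->{s'}|s's]; last first.
    by have [+ _] := IH s' (leq_trans s's sn) (leq_trans (ltnW s's) st); exact.
  case: s sn st mG => [|s] sn st mG.
    apply: (eq_measurable_fun (fun=> w0 i 0 : R)); last exact: measurable_cst.
    by move=> o _; rewrite w_init.
  have [mws _] := IH s sn (ltnW st).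
  apply: (eq_measurable_fun (fun o : T t => w s o i 0 - eta s * G s o i 0 : R)).
    by move=> o _; rewrite iterate_succ; move: (G s o) => g; rewrite !mxE.
  by apply: measurable_funB => //; apply: measurable_funM => //; exact: mG.
split=> i; first exact: mw.
(* The guard in the summand repeats the range of the sum, because measurability of the masks is
   known only inside the window. *)
apply: (eq_measurable_fun (fun o : T t => w (s - tau)%N o i 0 -
   \sum_((s - tau)%N <= j < s) if (s - tau <= j < s)%N then
      eta j * (Sigma s j o i i * G j o i 0) else 0 : R)).
  move=> o _; rewrite read_vector [RHS]mxE [(- _ : 'cV_d) i 0]mxE summxE;
    congr (_ - _).
  rewrite big_nat [RHS]big_nat; apply: eq_bigr => j jr;
    rewrite jr [RHS]mxE mask_mulE//.
  exact: what_consistent.1.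
apply: measurable_funB; first by apply: mw; exact: leq_subr.
apply: measurable_sum => j; case: (boolP (s - tau <= j < s)%N) => [jr|_];
  last exact: measurable_cst.
apply: measurable_funM => //; apply: measurable_funM; first exact: mask_adapted.
by apply: mG; case/andP: jr.
Qed.

Lemma update_adapted t j i : (j < t)%N ->
  measurable_fun setT (fun o : T t => G j o i 0).
Proof.
move=> jt; have [_ mwh] := iterate_adapted (ltnW jt).
exact: (measurable_update_comp f_diff f_meas f_smooth S_meas i (sample_adapted
  jt) mwh).
Qed.

Lemma discounted_sum_adapted t s : (s <= t)%N ->
  measurable_fun setT (fun o : T t => discounted_sum (x o) s).
Proof.
elim: s => [_|s IH st] /=; first exact: measurable_cst.
apply: measurable_funD; first by apply: measurable_funM => //;
  exact: IH (ltnW st).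
apply: measurable_funM => //; apply: measurable_dot => i; exact: update_adapted.
Qed.

(** * The potential and its drift *)

Context (xi : {RV P >-> Xi}) (mu : R)
  (f_int : forall v, P.-integrable setT (fun o => (f (xi o) v)%:E))
  (f_unbiased : unbiased_gradient P f xi)
  (mu_gt0 : 0 < mu)
  (F_sc : strongly_convex mu (objective P f xi))
  (L_gt0 : 0 < L)
  (f_convex : forall x, grad_convex (f x))
  (wstar_min : is_minimizer (objective P f xi) wstar)
  (N_fin : (2%R%:E * 'E_P[fun o => (enorm (grad (f (xi o)) wstar) ^+ 2)%R] <
    +oo)%E)
  (xis_law : forall t, same_law (xis t) xi)
  (step_indep : forall t,
    independent_of_history P (fun o => (xis t o, us t o))
      (history tau xis us Sigma t)).

(* The discounted sum loses half of its value at each step; with this weight, a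
   quarter pays for the delay error (4 L + mu) eta_t |w_t - what_t|^2 and a
   quarter for the contraction factor 1 - eta_t mu / 2. *)
Definition delay_weight : R := 4 * (4 * L + mu) * delay_const.

Definition potential (t : nat) (o : Omega) : R :=
  dot (w t o - wstar) (w t o - wstar) + delay_weight * discounted_sum (x o) t.

Lemma delay_const_ge0 : 0 <= delay_const.
Proof. by rewrite !mulr_ge0 ?exprn_ge0. Qed.

Lemma delay_weight_ge0 : 0 <= delay_weight.
Proof. by rewrite !mulr_ge0 ?delay_const_ge0 ?addr_ge0 ?mulr_ge0 ?(ltW L_gt0)
  ?(ltW mu_gt0). Qed.

Lemma potential_ge0 t o : 0 <= potential t o.
Proof.
by rewrite addr_ge0 ?dot_ge0// mulr_ge0 ?delay_weight_ge0 ?discounted_sum_ge0.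
Qed.

Lemma distance_adapted t s i : (s <= t)%N ->
  measurable_fun setT (fun o : T t => (w s o - wstar) i 0).
Proof.
move=> st; have [/(_ i) mw _] := iterate_adapted st.
apply: (eq_measurable_fun (fun o : T t => w s o i 0 - wstar i 0 : R)).
  by move=> o _; rewrite !mxE.
exact: measurable_funB.
Qed.

Lemma potential_adapted t : measurable_fun setT (potential t : T t -> R).
Proof.
apply: measurable_funD.
  by apply: measurable_dot => i; exact: distance_adapted.
by apply: measurable_funM => //; exact: discounted_sum_adapted.
Qed.

Lemma measurable_potential t : measurable_fun setT (potential t).
Proof.
by move=> _ A mA; apply: (@history_measurable t); exact: potential_adapted.
Qed.

(** The newest term of the discounted sum joins the step energy, so that the current sample enters
    through a single function. *)
Lemma potential_succ t o : potential t.+1 o =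
  step_energy D f S wstar (eta t) (delay_weight * eta t ^+ 3)
    (w t o) (what t o) (xis t o, us t o)
  + delay_weight / 2 * discounted_sum (x o) t.
Proof.
rewrite /potential iterate_succ /step_energy -/(G t o) /= /x.
rewrite (addrAC (w t o));
  move: (dot _ _) (dot _ _) (discounted_sum _ _) => a b c.
by field.
Qed.

(** The distance term contracts by exactly [1 - a]. Of the discounted sum half is left after the
    step; the other half pays for the delay error and for [a] times the sum. The noise is paid by
    [r - r']. *)
Lemma potential_drift t (A : set Omega) (r r' : R) :
  <<s history_gen t >> A -> 0 <= r' ->
  let a := eta t * mu / 2 in
  let c := (eta t ^+ 2 + delay_weight * eta t ^+ 3) * D%:R in
  a <= 1 / 4 -> c * (8 * L) <= eta t -> c * grad_noise f xi wstar <= r - r' ->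
  (\int[P]_(o in A) (potential t.+1 o + r')%:E +
     a%:E * \int[P]_(o in A) (potential t o)%:E
     <= \int[P]_(o in A) (potential t o + r)%:E)%E.
Proof.
move=> FA r'0 a c ha hc hr.
have mA := history_measurable FA.
have et0 := ltW (eta_gt0 t).
have a0 : 0 <= a by rewrite /a divr_ge0// mulr_ge0// ltW.
have k0 : 0 <= delay_weight * eta t ^+ 3 by rewrite mulr_ge0 ?delay_weight_ge0//
  exprn_ge0.
(* [rest] collects everything on the left that is determined by the history, so that the whole
   left-hand side becomes one integral to which [freezing_le] applies. *)
pose rest o := delay_weight / 2 * discounted_sum (x o) t + r' + a * potential t
  o.
have rest0 o : 0 <= rest o.
  apply: addr_ge0; last by apply: mulr_ge0 => //; exact: potential_ge0.
  apply: addr_ge0 => //; apply: mulr_ge0; last exact: discounted_sum_ge0.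
  exact: divr_ge0 delay_weight_ge0 _.
pose h o p := step_energy D f S wstar (eta t) (delay_weight * eta t ^+ 3)
    (w t o) (what t o) p + rest o.
have mrest : measurable_fun setT (rest : T t -> R).
  apply: measurable_funD; last first.
    by apply: measurable_funM => //; exact: potential_adapted.
  apply: measurable_funD => //; apply: measurable_funM => //.
  exact: discounted_sum_adapted.
have [mw mwh] := iterate_adapted (leqnn t).
have mh : measurable_fun setT (fun p : T t * (Xi * nat) => h p.1 p.2).
  apply: measurable_funD; last exact: (measurableT_comp mrest measurable_fst).
  have mw' i : measurable_fun setT (fun p : T t * (Xi * nat) => w t p.1 i 0).
    exact: (measurableT_comp (mw i) measurable_fst).
  have mwh' i : measurable_fun setT (fun p : T t * (Xi * nat) => what t p.1 i
    0).
    exact: (measurableT_comp (mwh i) measurable_fst).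
  exact: (measurable_step_energy wstar f_diff f_meas f_smooth S_meas (eta t)
    (delay_weight * eta t ^+ 3) measurable_snd mw' mwh').
have h0 o p : 0 <= h o p by rewrite addr_ge0 ?step_energy_ge0.
have mX : measurable_fun setT (fun o => (xis t o, us t o)).
  by apply: measurable_fun_pair; exact: measurable_funP.
have mV B s : measurable B -> measurable_fun B (fun o => (potential s o)%:E :
  \bar R).
  by move=> mB; apply/measurable_EFinP; apply: measurable_funTS;
    exact: measurable_potential.
have mVr B s q : measurable B -> measurable_fun B (fun o => (potential s o +
  q)%:E : \bar R).
  move=> mB; apply/measurable_EFinP; apply: measurable_funTS.
  by apply: measurable_funD => //; exact: measurable_potential.
have -> : (\int[P]_(o in A) (potential t.+1 o + r')%:E +
     a%:E * \int[P]_(o in A) (potential t o)%:E =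
   \int[P]_(o in A) (h o (xis t o, us t o))%:E)%E.
  rewrite -ge0_integralZl_EFin//; last 2 first.
  - by move=> o _; rewrite lee_fin potential_ge0.
  - exact: mV.
  rewrite -ge0_integralD//.
  - by apply: eq_integral => o _;
    rewrite -EFinM -EFinD potential_succ /h /rest !addrA.
  - by move=> o _; rewrite lee_fin addr_ge0// potential_ge0.
  - exact: mVr.
  - by move=> o _; rewrite -EFinM lee_fin mulr_ge0// potential_ge0.
  - by apply: measurable_funeM; exact: mV.
apply: (@freezing_le _ _ _ _ _ P (history_gen t) (fun o => (xis t o, us t o)) h
  (fun o => potential t o + r)) => //.
- exact: history_measurable.
- by apply: measurable_funD => //; exact: measurable_potential.
move=> o; rewrite /h.
have mstep : measurable_fun setT (fun o' => step_energy D f S wstar (eta t)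
    (delay_weight * eta t ^+ 3) (w t o) (what t o) (xis t o', us t o')).
  have mc (v : 'cV[R]_d) i : measurable_fun setT (fun _ : Omega => v i 0) by [].
  exact: (measurable_step_energy wstar f_diff f_meas f_smooth S_meas (eta t)
    (delay_weight * eta t ^+ 3) mX (mc (w t o)) (mc (what t o))).
under eq_integral do rewrite EFinD.
rewrite ge0_integralD//; last 3 first.
- by move=> o' _; rewrite lee_fin step_energy_ge0.
- exact/measurable_EFinP.
- by move=> o' _; rewrite lee_fin.
rewrite integral_cst// [X in (_ + _ * X)%E](_ : _ = 1%E);
  last exact: probability_setT.
rewrite mule1.
have step := expected_step f_diff f_meas f_int f_unbiased mu_gt0 F_sc L_gt0
  f_smooth f_convex wstar_min N_fin S_filters S_meas (w t o) (what t o)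
  (xis_law t) (us_unif t) et0 k0 hc.
apply: le_trans (leeD step (lexx _)) _; rewrite -EFinD lee_fin.
have derr := delay_error t o.
move: hr; rewrite -/c /rest /potential -/a => hr.
move: derr.
set dd := dot (w t o - what t o) _; set A0 := dot (w t o - wstar) _.
set W := discounted_sum (x o) t => derr.
have W0 : 0 <= W by exact: discounted_sum_ge0.
have Cd : delay_weight = 4 * (4 * L + mu) * delay_const by [].
have c0 := delay_weight_ge0.
have Lm0 : 0 <= 4 * L + mu by rewrite addr_ge0 ?mulr_ge0 ?(ltW L_gt0) ?(ltW
  mu_gt0).
have h1 : (4 * L + mu) * (eta t * dd) <= (4 * L + mu) * (delay_const * W) by
  exact: ler_wpM2l.
have h2 : (4 * L + mu) * (delay_const * W) = delay_weight * W / 4 by rewrite Cd;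
  field.
have h3 : a * (delay_weight * W) <= 1 / 4 * (delay_weight * W).
  by rewrite ler_wpM2r// mulr_ge0.
rewrite h2 in h1; rewrite -subr_ge0.
move: h1 h3 hr; rewrite -subr_ge0 => h1; rewrite -subr_ge0 => h3;
  rewrite -subr_ge0 => hr.
apply: le_trans (addr_ge0 (addr_ge0 h1 h3) hr) _.
by rewrite le_eqVlt; apply/orP; left; apply/eqP; field.
Qed.

End Hogwild.

(** * Choice of the constants and conclusion *)

Theorem theorem5 (R : realType) (dO dX : measure_display)
  (Omega : measurableType dO) (Xi : measurableType dX)
  (P : probability Omega R) (d : nat)
  (f : Xi -> 'cV[R]_d -> R) (xi : {RV P >-> Xi})
  (mu L : R) (wstar : 'cV[R]_d)
  (D : nat) (S : Xi -> nat -> 'M[R]_d)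
  (tau : nat) (k beta : R) (eta : nat -> R)
  (xis : nat -> {RV P >-> Xi}) (us : nat -> {RV P >-> nat})
  (Sigma : nat -> nat -> Omega -> 'M[R]_d)
  (w0 : 'cV[R]_d) (w what : nat -> Omega -> 'cV[R]_d)
  (f_diff : forall x v, differentiable (f x) v)
  (f_meas : forall v, measurable_fun setT (fun x => f x v))
  (f_int : forall v, P.-integrable setT (fun o => (f (xi o) v)%:E))
  (f_unbiased : unbiased_gradient P f xi)
  (mu_gt0 : 0 < mu)
  (F_sc : strongly_convex mu (objective P f xi))
  (L_gt0 : 0 < L)
  (f_smooth : forall x, smooth L (f x))
  (f_convex : forall x, grad_convex (f x))
  (wstar_min : unique (is_minimizer (objective P f xi)) wstar)
  (N_fin : (2%R%:E * 'E_P[fun o => (enorm (grad (f (xi o)) wstar) ^+ 2)%R] <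
    +oo)%E)
  (D_gt0 : (0 < D)%N)
  (S_filters : forall x, is_filter_family D (f x) (S x))
  (S_meas : forall u a b,
    measurable_fun [set x | (u < nfilters D (f x))%N] (fun x => S x u a b))
  (xis_law : forall t, same_law (xis t) xi)
  (xis_indep : mutually_independent xis)
  (us_unif : forall t,
    uniform_index (fun x => nfilters D (f x)) (xis t) (us t))
  (Sigma_meas : forall t j a b, (t - tau <= j < t)%N ->
    measurable_fun setT (fun o => Sigma t j o a b))
  (step_indep : forall t,
    independent_of_history P (fun o => (xis t o, us t o))
      (history tau xis us Sigma t))
  (beta_gt0 : 0 < beta)
  (k_ge : 3 * tau%:R <= k)
  (eta_def : forall t, eta t = 1 / (L * D%:R * (2 + beta) * (k + t%:R)))
  (eta_bounds : forall t, 0 < eta t < 1 / (4 * L * D%:R))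
  (w_init : forall o, w 0%N o = w0)
  (w_step : hogwild_recursion f D S eta xis us w what)
  (what_consistent : consistent_memory f D S eta tau xis us Sigma w what) :
  {ae P, forall o, enorm (w t o - wstar) @[t --> \oo] --> 0}.
Proof.
have wmin := wstar_min.1.
have eta_gt0 t : 0 < eta t by case/andP: (eta_bounds t).
have LDb : 0 < L * D%:R * (2 + beta).
  by rewrite !mulr_gt0// ?ltr0n// addr_gt0.
(* Positivity of [k] comes from that of [eta 0]; the bound by [3 * tau] gives only [0 <= k] when
   [tau] is zero. *)
have k0 : 0 < k.
  have := eta_gt0 0%N; rewrite eta_def addr0 div1r invr_gt0 pmulr_rgt0//.
have kt t : 0 < k + t%:R by rewrite ltr_wpDr.
pose q := (L * D%:R * (2 + beta))^-1.
have q0 : 0 < q by rewrite invr_gt0.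
have etaE t : eta t = q / (k + t%:R) by rewrite eta_def div1r invfM.
have eta_decr t : eta t.+1 <= eta t.
  by rewrite !etaE ler_pM2l// lef_pV2 ?posrE// lerD2l ler_nat.
have eta_le0 t : eta t <= eta 0%N.
  by elim: t => // t; apply: le_trans.
pose N := grad_noise f xi wstar.
have N0 : 0 <= N.
  by rewrite mulr_ge0// Rintegral_ge0// => o _; exact: dot_ge0.
pose C := delay_weight L tau mu.
have C0 : 0 <= C by exact: delay_weight_ge0.
(* Since the stepsizes decrease, the coefficient that must be at most [eta t] is at most
   [M * eta t ^+ 2]. *)
pose M := (1 + C * eta 0%N) * (D%:R * (8 * L)).
have b0 : 0 <= 1 + C * eta 0%N by rewrite addr_ge0// mulr_ge0// ltW.
have M0 : 0 <= M by rewrite !mulr_ge0// ltW.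
pose c' := q ^+ 2 * ((1 + C * eta 0%N) * (D%:R * N)).
have B0 : 0 <= (1 + C * eta 0%N) * (D%:R * N) by rewrite mulr_ge0// mulr_ge0.
have c'0 : 0 <= c' by exact: mulr_ge0 (sqr_ge0 _) B0.
(* The noise of step [t] is at most [c' / (k + t) ^ 2], and the decrement of [r], equal to
   [2 * c' / ((k + t) * (k + t + 1))], covers it once [k + t >= 1]. *)
pose r t := 2 * c' * (k + t%:R)^-1.
have r0 t : 0 <= r t.
  by apply: mulr_ge0; [exact: mulr_ge0|rewrite invr_ge0 ltW].
have rto : r @ \oo --> 0.
  by rewrite -(mulr0 (2 * c')); apply: cvgMr; exact: cvg_inv_shift.
pose a t := eta t * mu / 2.
have a0 t : 0 <= a t by rewrite divr_ge0// mulr_ge0// ltW.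
have dva : ~ cvgn (series a).
  have -> : a = (fun t => (q * mu / 2) / (k + t%:R)).
    by apply/funext => t; rewrite /a etaE; field; rewrite gt_eqF.
  by apply: dvg_inv_shift => //; rewrite divr_gt0// mulr_gt0.
(* One condition serves two needs: [M * eta t <= 1], and [mu * eta t <= 1 / 2], that is
   [a t <= 1 / 4]. *)
have [s0 hs0] : exists s, forall t, (s <= t)%N -> (M + 2 * mu) * eta t <= 1.
  have Mq0 : 0 < (M + 2 * mu) * q by rewrite mulr_gt0// ltr_wpDl// mulr_gt0.
  have e0 : 0 < ((M + 2 * mu) * q)^-1 by rewrite invr_gt0.
  have /cvgrPdist_le/(_ _ e0)[s _ hs] := cvg_inv_shift k0.
  exists s => t /hs; rewrite sub0r normrN ger0_norm ?invr_ge0 ?(ltW (kt t))// =>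
    h.
  by rewrite etaE mulrA -ler_pdivlMl// mulr1.
(* The extra unit ensures [t >= 1], hence [k + t >= 1]. *)
pose s := s0.+1.
have drift t A : (s <= t)%N -> <<s history_gen tau xis us Sigma t >> A ->
    (\int[P]_(o in A) (potential f L wstar D S tau eta xis us w what mu t.+1 o +
      r t.+1)%:E +
     (a t)%:E * \int[P]_(o in A) (potential f L wstar D S tau eta xis us w what
       mu t o)%:E
     <= \int[P]_(o in A) (potential f L wstar D S tau eta xis us w what mu t o +
       r t)%:E)%E.
  move=> st FA; have hM := hs0 t (ltnW st).
  have et := eta_gt0 t; have et0 := ltW et.
  have mue : 0 <= mu * eta t by rewrite mulr_ge0// ltW.
  have Me : 0 <= M * eta t by rewrite mulr_ge0.
  have cle : 1 + C * eta t <= 1 + C * eta 0%N by rewrite lerD2l ler_wpM2l.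
  apply: potential_drift => //.
  - exact: Sigma_meas.
  - exact: what_consistent.
  - lra.
  - rewrite -/C; have -> : (eta t ^+ 2 + C * eta t ^+ 3) * D%:R * (8 * L) =
      eta t * (eta t * ((1 + C * eta t) * (D%:R * (8 * L)))) by ring.
    rewrite -[leRHS]mulr1 ler_wpM2l//.
    apply: (@le_trans _ _ (eta t * M)); last by rewrite mulrC; lra.
    by rewrite ler_wpM2l// /M ler_wpM2r// !mulr_ge0// ltW.
  rewrite -/C -/N; have -> : (eta t ^+ 2 + C * eta t ^+ 3) * D%:R * N =
      eta t ^+ 2 * ((1 + C * eta t) * (D%:R * N)) by ring.
  apply: (@le_trans _ _ (c' * ((k + t%:R)^-1 * (k + t%:R)^-1))).
    have -> : c' * ((k + t%:R)^-1 * (k + t%:R)^-1) =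
        eta t ^+ 2 * ((1 + C * eta 0%N) * (D%:R * N)).
      by rewrite /c' (etaE t); ring.
    by rewrite ler_wpM2l ?sqr_ge0// ler_wpM2r// mulr_ge0.
  have kt1 : 1 <= k + t%:R.
    by rewrite ler_wpDl ?(ltW k0)// ler1n; exact: leq_ltn_trans st.
  have -> : r t - r t.+1 = c' * (2 * ((k + t%:R)^-1 - (k + t.+1%:R)^-1)) by
    rewrite /r; ring.
  rewrite ler_wpM2l// -[t.+1%:R]natr1 addrA;
    move: (k + t%:R) (kt t) kt1 => y y0 y1.
  have -> : 2 * (y^-1 - (y + 1)^-1) = 2 / (y + 1) * y^-1.
    by field; rewrite gt_eqF//= gt_eqF// addr_gt0.
  rewrite ler_wpM2r ?invr_ge0 ?(ltW y0)// -[leLHS]mul1r ler_pdivrMr//.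
  rewrite mulrAC ler_pdivlMr ?addr_gt0//; lra.
have mV t := measurable_potential wstar f_diff f_meas f_smooth S_filters S_meas
  us_unif Sigma_meas w_init w_step what_consistent mu t.
have V0 t o := potential_ge0 f wstar D S tau xis us w what eta_gt0 mu_gt0 L_gt0
  t o.
have FI t (A B : set Omega) : <<s history_gen tau xis us Sigma t >> A ->
    <<s history_gen tau xis us Sigma t >> B ->
    <<s history_gen tau xis us Sigma t >> (A `&` B).
  move=> FA FB.
  exact: (@measurableI _ (g_sigma_algebraType (history_gen tau xis us Sigma t))
    A B).
have FV t c : <<s history_gen tau xis us Sigma t >>
    [set o | potential f L wstar D S tau eta xis us w what mu t o <= c].
  apply: (@measurable_le_cst _ _ (g_sigma_algebraType (history_gen tau xis us
    Sigma t))).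
  exact: (potential_adapted wstar f_diff f_meas f_smooth S_filters S_meas
    us_unif w_init w_step what_consistent mu).
have := ae_cvg0_of_drift FI (fun t => @history_mono _ _ _ _ _ _ _ _ _ _ _ t)
  (fun t => history_measurable Sigma_meas (t := t)) FV mV V0 a0 dva r0 rto
    drift.
apply: filterS => o Vo; apply/cvgrPdist_lt => e e0.
(* The squared distance is at most the potential, so it suffices that the latter falls below
   [e ^+ 2]. *)
have /cvgrPdist_lt/(_ _ (exprn_gt0 2 e0)) := Vo.
apply: filterS => t; rewrite !sub0r !normrN ger0_norm// ger0_norm ?enorm_ge0//
  => h.
rewrite -(ltr_pXn2r (_ : 0 < 2)%N)// ?nnegrE ?enorm_ge0 ?(ltW e0)// enorm_sqr.
apply: le_lt_trans h; rewrite lerDl mulr_ge0//.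
by apply: discounted_sum_ge0 => j; rewrite mulr_ge0 ?dot_ge0// exprn_ge0// ltW.
Qed.
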